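(* Let $I\subseteq[d]$ be nonempty. Let $f_j\in BV([a_j,b_j])$ be nonnegative one-dimensional probability densities: $f_j\ge0$, $\int_{J_j}f_j(t)\,dt=1$, $j=1,\ldots,d$. Define $f(\omega):=\prod_{j=1}^df_j(\omega_j)$. Then $f\in BV(S)$ and: (i) For every $i\in[d]$, $$D_if=Df_i\otimes\bigotimes_{j\ne i}\bigl(f_j(t_j)\,dt_j\bigr),$$ with the tensor factors placed in coordinate order. Consequently, $$|D_if|(S)=|Df_i|(J_i),\qquad\mathrm{TV}_I(f;S)=\sum_{i\in I}|Df_i|(J_i).$$ (ii) $$D_If=\left(\bigotimes_{i\in I}Df_i\right)\otimes\left(\bigotimes_{j\notin I}f_j(t_j)\,dt_j\right),$$ and $$|D_If|(S)=\prod_{i\in I}|Df_i|(J_i).$$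
   Context: $d\ge 1$, $[d]=\{1,\dots,d\}$, $S=\prod_{j=1}^dJ_j$, $J_j=[a_j,b_j]$ with $a_j<b_j$. All distributional derivatives are relative to the interior: $D_if$ and $D_If$ are the distributional derivatives on the interior of $S$, $Df_j$ is the derivative measure on $(a_j,b_j)$, and $|D_if|(S)$, $|D_If|(S)$, $|Df_j|(J_j)$ denote total variation masses on the respective interiors (no boundary jumps are counted). For $I=\{i_1<\cdots<i_k\}$ the mixed distributional derivative is $\langle D_If,\zeta\rangle=(-1)^k\int f\,\partial_{i_1}\cdots\partial_{i_k}\zeta\,dx$ for $\zeta\in C_c^\infty(\operatorname{int}S)$, identified with a finite signed Radon measure when it is represented by one. $\mathrm{TV}_I(f;S)=\sum_{i\in I}|D_if|(S)$. *)

(* Defs.v *)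
From HB Require Import structures.
From mathcomp Require Import all_boot all_order all_algebra.
From mathcomp Require Import all_classical all_reals all_analysis.

Set Implicit Arguments.
Unset Strict Implicit.
Unset Printing Implicit Defensive.

Import Order.TTheory GRing.Theory Num.Theory.
Import numFieldNormedType.Exports.

Local Open Scope classical_set_scope.
Local Open Scope ring_scope.

(* The sigma-algebra generated by the coordinates, i.e. the Borel one. *)
Definition rV_display : measure_display.
Proof. exact: default_measure_display. Qed.

Section measurable_rV.
Context {R : realType} (n : nat).

Definition rV_coord (i : 'I_n) (x : 'rV[R]_n) : measurableTypeR R := x ord0 i.

Let rV_set0 : g_sigma_preimage rV_coord set0.
Proof. exact: sigma_algebra0. Qed.

Let rV_setC A : g_sigma_preimage rV_coord A -> g_sigma_preimage rV_coord (~` A).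
Proof. exact: sigma_algebraC. Qed.

Let rV_bigcup (F : _^nat) : (forall i, g_sigma_preimage rV_coord (F i)) ->
  g_sigma_preimage rV_coord (\bigcup_i (F i)).
Proof. exact: sigma_algebra_bigcup. Qed.

HB.instance Definition _ := @isMeasurable.Build rV_display
  'rV[R]_n (g_sigma_preimage rV_coord) rV_set0 rV_setC rV_bigcup.

Lemma measurable_rV_coord (i : 'I_n) : measurable_fun setT (rV_coord i).
Proof.
move=> _ A mA; rewrite setTI; apply: sub_sigma_algebra => /=.
rewrite -bigcup_seq/=; exists i => /=; first by rewrite mem_index_enum.
by exists A => //; rewrite setTI.
Qed.

End measurable_rV.

Section rV_cons.
Context {R : realType} (n : nat).

Definition rV_cons (p : 'rV[R]_n * measurableTypeR R) : 'rV[R]_n.+1 :=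
  \row_i (if unlift ord0 i is Some j then p.1 ord0 j else p.2).

Lemma measurable_rV_cons : measurable_fun setT rV_cons.
Proof.
suff coord i : measurable_fun setT (rV_coord i \o rV_cons).
  have : g_sigma_preimage (fun i => rV_coord i \o rV_cons) `<=` measurable.
    apply: smallest_sub; first exact: sigma_algebra_measurable.
    rewrite -bigcup_seq; apply: bigcup_sub => i _ _ [B mB <-].
    exact: coord.
  rewrite g_sigma_preimage_comp => sub _ A mA.
  by apply: sub; exists A.
have [j ->|->] := unliftP ord0 i.
  have -> : rV_coord (lift ord0 j) \o rV_cons = rV_coord j \o fst.
    by apply/funext => p; rewrite /rV_coord /= mxE liftK.
  by apply: measurableT_comp => //; exact: measurable_rV_coord.
have -> : rV_coord ord0 \o rV_cons = snd.
  by apply/funext => p; rewrite /rV_coord /= mxE unlift_none.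
exact: measurable_snd.
Qed.

End rV_cons.

Definition rect {R : realType} (n : nat) (A : 'I_n -> set R) : set 'rV[R]_n :=
  [set x | forall j, A j (x ord0 j)].

(* The long name is the canonical measure structure on the pushforward by
   rV_cons, given here the proof that rV_cons is measurable. *)
Fixpoint lebesgue_rV {R : realType} (n : nat) :
    {measure set 'rV[R]_n -> \bar R} :=
  match n with
  | 0 => dirac (0 : 'rV[R]_0)
  | m.+1 => measure_function_pushforward__canonical__measure_function_Measure
      (lebesgue_rV m \x (@lebesgue_measure R))%E (measurable_rV_cons (n := m))
  end.

Lemma measurable_rect {R : realType} (n : nat)
    (A : 'I_n -> set (measurableTypeR R)) :
  (forall j, measurable (A j)) -> measurable (rect A).
Proof.
move=> mA; rewrite (_ : rect A = \bigcap_(j in setT) (rV_coord j @^-1` A j)).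
  apply: fin_bigcap_measurable => // j _.
  by rewrite -[X in measurable X]setTI; exact: measurable_rV_coord.
by apply/seteqP; split=> [x Ax j _|x Ax j]; exact: Ax.
Qed.

Lemma lebesgue_rV_rect {R : realType} (n : nat)
    (A : 'I_n -> set (measurableTypeR R)) : (forall j, measurable (A j)) ->
  lebesgue_rV n (rect A) = (\prod_(j < n) lebesgue_measure (A j))%E.
Proof.
elim: n A => [|n IHn] A mA.
  by rewrite big_ord0 /= diracE mem_set// => -[].
rewrite big_ord_recl /= /pushforward.
rewrite (_ : @rV_cons R n @^-1` rect A =
    rect (fun j => A (lift ord0 j)) `*` A ord0); last first.
  apply/seteqP; split=> [[x t] /= xtA|[x t] /= [xA tA] j].
    split=> [j|]; first by have := xtA (lift ord0 j); rewrite mxE liftK.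
    by have := xtA ord0; rewrite mxE unlift_none.
  by have [i ->|->] := unliftP ord0 j; rewrite mxE ?liftK ?unlift_none.
rewrite product_measure1E//; last exact: measurable_rect.
by rewrite IHn// muleC.
Qed.

Section charges.
Context d (T : measurableType d) (R : realType).
Implicit Type mu : {charge set T -> \bar R}.

(* The Jordan decomposition does not depend on the Hahn decomposition chosen
   here, by Hahn_decomposition_uniq. *)
Definition hahn_pos mu : set T := projT1 (cid (Hahn_decomposition mu)).

Definition hahn_neg mu : set T :=
  projT1 (cid (projT2 (cid (Hahn_decomposition mu)))).

Definition hahn_posneg mu : hahn_decomposition mu (hahn_pos mu) (hahn_neg mu) :=
  projT2 (cid (projT2 (cid (Hahn_decomposition mu)))).

Definition charge_integral mu (g : T -> R) : R :=
  \int[jordan_pos (hahn_posneg mu)]_x g x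
  - \int[jordan_neg (hahn_posneg mu)]_x g x.

Definition charge_tv mu (A : set T) : \bar R :=
  charge_variation (hahn_posneg mu) A.

(* A signed measure on an open set U is encoded as a charge on the whole space
   concentrated on U. *)
Definition concentrated mu (U : set T) :=
  forall A, measurable A -> A `&` U = set0 -> mu A = 0%E.

End charges.

Section derivatives_in_dimension_one.
Context {R : realType} (a b : R).

(* C_c^oo(]a, b[), functions being extended by zero to R; the continuity of
   each derivative follows from the existence of the next one. *)
Definition test_fun1 (zeta : R -> R) :=
  [/\ forall n x, derivable (derive1n n zeta) x 1,
      compact (closure [set x | zeta x != 0]) &
      closure [set x | zeta x != 0] `<=` `]a, b[ ].

Definition is_derivative1 (f : R -> R)
    (mu : {charge set (measurableTypeR R) -> \bar R}) :=
  (concentrated mu `]a, b[) /\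
  forall zeta, test_fun1 zeta ->
    charge_integral mu zeta =
    - \int[lebesgue_measure]_(x in `]a, b[) (f x * derive1 zeta x).

(* L^1 classes are given by Borel representatives. *)
Definition BV1 (f : R -> R) :=
  lebesgue_measure.-integrable `[a, b] (EFin \o f) /\
  exists mu, is_derivative1 f mu.

(* There is at most one derivative measure up to its values on non-measurable
   sets; czero is a dummy value. *)
Definition Dmeasure1 (f : R -> R) : {charge set (measurableTypeR R) -> \bar R} :=
  if pselect (exists mu, is_derivative1 f mu) is left h
  then projT1 (cid h) else czero.

Lemma Dmeasure1P (f : R -> R) : BV1 f -> is_derivative1 f (Dmeasure1 f).
Proof. by case=> _ h; rewrite /Dmeasure1; case: pselect => // h'; case: cid. Qed.

(* f(t) dt on ]a, b[ *)
Definition density (f : R -> R) (A : set (measurableTypeR R)) : \bar R :=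
  (\int[lebesgue_measure]_(t in A `&` `]a, b[) (f t)%:E)%E.

End derivatives_in_dimension_one.

Section derivatives.
Context {R : realType} (d : nat) (a b : 'I_d -> R).

Definition box : set 'rV[R]_d := rect (fun j => `[a j, b j]%classic).

Definition partial (i : 'I_d) (g : 'rV[R]_d -> R) : 'rV[R]_d -> R :=
  fun x => 'D_(delta_mx ord0 i) g x.

(* partials [:: i1; ...; ik] g = partial i1 (... (partial ik g)) *)
Definition partials (s : seq 'I_d) (g : 'rV[R]_d -> R) : 'rV[R]_d -> R :=
  foldr partial g s.

(* All iterated partial derivatives exist and are continuous. In several
   variables their existence alone would not make them continuous. *)
Definition smooth (g : 'rV[R]_d -> R) :=
  forall s, continuous (partials s g) /\
    forall i x, derivable (partials s g) x (delta_mx ord0 i).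

Definition test_fun (zeta : 'rV[R]_d -> R) :=
  [/\ smooth zeta,
      compact (closure [set x | zeta x != 0]) &
      closure [set x | zeta x != 0] `<=` box°].

(* [enum I] lists I in increasing order. *)
Definition is_mixed_derivative (I : {set 'I_d}) (f : 'rV[R]_d -> R)
    (mu : {charge set 'rV[R]_d -> \bar R}) :=
  concentrated mu box° /\
  forall zeta, test_fun zeta ->
    charge_integral mu zeta =
    (-1) ^+ #|I| *
    \int[lebesgue_rV d]_(x in box°) (f x * partials (enum I) zeta x).

Definition has_mixed_derivative (I : {set 'I_d}) (f : 'rV[R]_d -> R) :=
  exists mu, is_mixed_derivative I f mu.

(* As for Dmeasure1, unique on measurable sets when it exists. *)
Definition Dmeasure (I : {set 'I_d}) (f : 'rV[R]_d -> R) :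
    {charge set 'rV[R]_d -> \bar R} :=
  if pselect (has_mixed_derivative I f) is left h
  then projT1 (cid h) else czero.

Lemma DmeasureP (I : {set 'I_d}) (f : 'rV[R]_d -> R) :
  has_mixed_derivative I f -> is_mixed_derivative I f (Dmeasure I f).
Proof. by rewrite /Dmeasure; case: pselect => // h _; case: cid. Qed.

Definition BV (f : 'rV[R]_d -> R) :=
  (lebesgue_rV d).-integrable box (EFin \o f) /\
  forall i, has_mixed_derivative [set i]%SET f.

Definition TV (I : {set 'I_d}) (f : 'rV[R]_d -> R) : \bar R :=
  (\sum_(i in I) charge_tv (Dmeasure [set i]%SET f) box°)%E.

End derivatives.

(* mu is the product of the nu j: it is determined, on measurable sets, by its
   values on rectangles. The nu j are only meant to be finite signed measures,
   so the extended-real product involves no infinity. *)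
Definition is_tensor {R : realType} (d : nat)
    (mu : {charge set 'rV[R]_d -> \bar R})
    (nu : 'I_d -> set (measurableTypeR R) -> \bar R) :=
  forall A : 'I_d -> set (measurableTypeR R), (forall j, measurable (A j)) ->
    mu (rect A) = (\prod_(j < d) nu j (A j))%E.

(* Main.v *)
Require Import Defs.
From HB Require Import structures.
From mathcomp Require Import all_boot all_order all_algebra.
From mathcomp Require Import all_classical all_reals all_analysis.
From mathcomp Require Import measurable_realfun ring lra.

Set Implicit Arguments.
Unset Strict Implicit.
Unset Printing Implicit Defensive.

Import Order.TTheory GRing.Theory Num.Theory.
Import numFieldNormedType.Exports.

Local Open Scope classical_set_scope.
Local Open Scope ring_scope.

(** The case of general [I] contains that of the partial derivatives, for which
    [I] is a singleton. Write every one-dimensional factor of the expected tensor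
    product, whether a derivative measure or f_j(t) dt, as a density h_j with
    respect to a positive measure la_j: for a derivative measure la_j is its
    total variation and h_j is its sign ([polar_decomposition]), otherwise la_j
    is the Lebesgue measure and h_j is f_j ([factor_density]). The tensor product
    is then the charge with density h_1(x_1) ... h_d(x_d) with respect to the
    product of the la_j, and Fubini's theorem gives its values on rectangles as
    products ([integral_tensor_fun_rect]). The total variation of a charge with
    density h is the integral of |h| ([charge_tv_density]), and the absolute
    value of a product function is again a product function, so the total
    variation factorises as well; the factors f_j(t) dt contribute 1.

    This charge represents the distributional derivative along [I]: in each
    coordinate the definition of the derivative measure is an integration by
    parts, and Fubini's theorem combines them
    ([tensor_fun_integration_by_parts]).

    The charge [Dmeasure a b I F] is only known through its integrals of test
    functions, so it must be shown to be unique ([eq_charge_test_fun]). The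
    algebra of functions generated by the constants, the coordinates and the
    composition with x^-k exp (- 1 / x), extended by 0, is stable under partial
    derivatives. The sets where an element u of it is positive form a pi-system
    that generates the Borel sets, and inside the open box the indicator of such
    a set is a bounded pointwise limit of test functions in the algebra
    ([cvg_cutoff]). *)

(** * Charges given by a density *)

Section charges_with_a_density.
Context d (T : measurableType d) (R : realType).
Implicit Types (nu : {charge set T -> \bar R})
  (la : {sigma_finite_measure set T -> \bar R}) (h g : T -> R).

(** The total variation and the integrals of a charge are defined through a
    Hahn decomposition chosen arbitrarily; writing the charge as [h la] makes
    them explicit. *)
Definition has_density nu la h :=
  la.-integrable setT (EFin \o h) /\
  forall A, measurable A -> nu A = (\int[la]_(x in A) (h x)%:E)%E.

Definition bounded_measurable g :=
  measurable_fun setT g /\ exists M, forall x, `|g x| <= M.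

Lemma bounded_measurable_integrable (m : {finite_measure set T -> \bar R}) g :
  bounded_measurable g -> m.-integrable setT (EFin \o g).
Proof.
move=> [mg [M gM]]; apply: measurable_bounded_integrable => //.
  exact: fin_num_fun_lty.
exists M; split; first exact: num_real.
by move=> r Mr x _; exact: le_trans (gM x) (ltW Mr).
Qed.

Lemma integrable_bounded_mul (m : {measure set T -> \bar R}) g h :
  bounded_measurable g -> m.-integrable setT (EFin \o h) ->
  m.-integrable setT (EFin \o (fun x => g x * h x)).
Proof.
move=> [mg [M gM]] ih.
apply: (@le_integrable _ _ _ m setT measurableT _ (fun x => M%:E * (h x)%:E)%E).
- apply/measurable_EFinP; apply: measurable_funM => //.
  by apply/measurable_EFinP; exact: measurable_int ih.
- move=> x _ /=; rewrite lee_fin !normrM ler_wpM2r//.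
  by rewrite (le_trans (gM x)) ?ler_norm.
- exact: integrableZl.
Qed.

(** By uniqueness, [h] is almost everywhere the Radon-Nikodym derivative of [m],
    for which the change of variables is known. *)
Lemma integral_density (m : {finite_measure set T -> \bar R}) la h g :
  la.-integrable setT (EFin \o h) ->
  (forall A, measurable A -> m A = \int[la]_(x in A) (h x)%:E)%E ->
  bounded_measurable g ->
  (\int[m]_x (g x)%:E = \int[la]_x (g x * h x)%:E)%E.
Proof.
move=> ih mE bg.
have mla : m `<< la.
  apply/null_content_dominatesP => A mA laA0.
  rewrite mE//; apply: null_set_integral => //.
  by apply: measurable_funTS; exact: measurable_int ih.
have ig := bounded_measurable_integrable m bg.
have mg : measurable_fun setT (EFin \o g) := measurable_int _ ig.
rewrite -(Radon_Nikodym_change_of_variables mla measurableT ig).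
apply: ae_eq_integral => //.
- apply: emeasurable_funM => //.
- by apply: measurable_int (integrable_bounded_mul bg ih).
under [X in ae_eq _ _ _ X]eq_fun do rewrite EFinM.
apply: ae_eqe_mul2l; apply: integral_ae_eq => //.
- by apply: Radon_Nikodym_integrable.
- exact: measurable_int ih.
by move=> E _ mE'; rewrite -Radon_Nikodym_integral// -mE.
Qed.

Lemma hahn_density nu la h : has_density nu la h ->
  hahn_decomposition nu [set x | 0 <= h x] [set x | h x < 0].
Proof.
move=> [ih nuE].
have mh : measurable_fun setT h.
  by apply/measurable_EFinP; exact: measurable_int ih.
have mP : measurable [set x | 0 <= h x].
  rewrite -[X in measurable X]setTI.
  rewrite (_ : [set x | _] = h @^-1` `[0, +oo[%classic); first exact: mh.
  by apply/seteqP; split=> x /=; rewrite in_itv /= andbT.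
have mN : measurable [set x | h x < 0].
  rewrite -[X in measurable X]setTI.
  rewrite (_ : [set x | _] = h @^-1` `]-oo, 0[%classic); first exact: mh.
  by apply/seteqP; split=> x /=; rewrite in_itv.
split.
- split=> // A mA AP; rewrite nuE//; apply: integral_ge0 => x /AP /=.
  by rewrite lee_fin.
- split=> // A mA AN; rewrite nuE// -leeN2 oppe0 -integralN.
    apply: integral_ge0 => x /AN /= hx.
    by rewrite lee_fin oppr_ge0 ltW.
  apply: (@integrable_add_def _ _ _ la A mA (EFin \o h)).
  by apply: integrableS ih.
- by apply/seteqP; split=> // x _ /=; case: (leP 0 (h x)); [left|right].
- by apply/seteqP; split=> // x [/=] /le_lt_trans/[apply]; rewrite ltxx.
Qed.

(** The values of a charge on the pieces of a set cut out by a Hahn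
    decomposition do not depend on the decomposition, so the chosen one may be
    replaced by the signs of [h]. *)
Lemma jordan_density nu la h (nula : has_density nu la h) A : measurable A ->
  jordan_pos (hahn_posneg nu) A =
    (\int[la]_(x in A) (Num.max (h x) 0)%:E)%E /\
  jordan_neg (hahn_posneg nu) A =
    (\int[la]_(x in A) (Num.max (- h x) 0)%:E)%E.
Proof.
move=> mA; have hP := hahn_density nula.
have [uP uN] := Hahn_decomposition_uniq (hahn_posneg nu) hP mA.
have [[mP _] [mN _] PN PN0] := hP; have [ih nuE] := nula.
have mh : measurable_fun setT h.
  by apply/measurable_EFinP; exact: measurable_int ih.
split.
  rewrite jordan_posE cjordan_posE /crestr0 mem_set// /crestr uP.
  rewrite nuE; last exact: measurableI.
  rewrite integral_mkcondr; apply: eq_integral => x _.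
  rewrite patchE; case: ifPn; rewrite ?inE ?notin_setE /=.
    by move=> h0; rewrite max_l.
  by move=> /negP; rewrite -ltNge => /ltW h0; rewrite max_r.
rewrite jordan_negE cjordan_negE /crestr0 mem_set// /crestr uN.
rewrite nuE; last exact: measurableI.
rewrite -integralN; last first.
  apply: (@integrable_add_def _ _ _ la (A `&` _) _ (EFin \o h)).
    exact: measurableI.
  by apply: integrableS ih => //; exact: measurableI.
rewrite [LHS]integral_mkcondr; apply: eq_integral => x _.
rewrite patchE; case: ifPn; rewrite ?inE ?notin_setE /=.
  by move=> h0; rewrite max_l// oppr_ge0 ltW.
by move=> /negP; rewrite -leNgt => h0; rewrite max_r// oppr_le0.
Qed.

Lemma charge_tv_density nu la h A : has_density nu la h -> measurable A ->
  charge_tv nu A = (\int[la]_(x in A) `|h x|%:E)%E.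
Proof.
move=> nula mA; have [p n] := jordan_density nula mA.
rewrite /charge_tv /charge_variation /= p n.
have mh : measurable_fun setT h.
  by apply/measurable_EFinP; exact: measurable_int nula.1.
rewrite -ge0_integralD//.
- apply: eq_integral => x _ /=; rewrite -EFinD; congr EFin.
  case: (leP 0 (h x)) => h0.
    by rewrite max_r ?oppr_le0// addr0 ger0_norm.
  by rewrite max_l ?oppr_ge0 ?(ltW h0)// add0r ltr0_norm.
- by move=> x _; rewrite lee_fin le_max lexx orbT.
- apply/measurable_EFinP; apply: measurable_funTS.
  exact: measurable_maxr.
- by move=> x _; rewrite lee_fin le_max lexx orbT.
- apply/measurable_EFinP; apply: measurable_funTS.
  by apply: measurable_maxr => //; exact: measurableT_comp.
Qed.

Lemma charge_integral_density nu la h g : has_density nu la h ->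
  bounded_measurable g ->
  charge_integral nu g = \int[la]_x (g x * h x).
Proof.
move=> nula bg; have [ih nuE] := nula.
have mh : measurable_fun setT h.
  by apply/measurable_EFinP; exact: measurable_int ih.
have ip : la.-integrable setT (EFin \o (fun x => Num.max (h x) 0)).
  apply: le_integrable ih => //.
    by apply/measurable_EFinP; exact: measurable_maxr.
  move=> x _ /=; rewrite lee_fin.
  by case: (leP 0 (h x)) => h0; rewrite ?normr0 ?normr_ge0.
have iN : la.-integrable setT (EFin \o (fun x => Num.max (- h x) 0)).
  apply: le_integrable ih => //.
    apply/measurable_EFinP; apply: measurable_maxr => //.
    exact: measurableT_comp.
  move=> x _ /=; rewrite lee_fin.
  by case: (leP 0 (- h x)) => h0; rewrite ?normr0 ?normr_ge0// normrN.
rewrite /charge_integral /Rintegral.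
rewrite (integral_density ip) //; last first.
  by move=> A mA; exact: (jordan_density nula mA).1.
rewrite (integral_density iN) //; last first.
  by move=> A mA; exact: (jordan_density nula mA).2.
rewrite -[LHS]/(Rintegral _ _ _ - Rintegral _ _ _) -RintegralB//; last 2 first.
- exact: integrable_bounded_mul.
- exact: integrable_bounded_mul.
congr fine; apply: eq_integral => x _; congr EFin => /=.
rewrite -mulrBr; congr (_ * _).
case: (leP 0 (h x)) => h0.
  by rewrite max_r ?oppr_le0// subr0.
by rewrite max_l ?oppr_ge0 ?(ltW h0)// sub0r opprK.
Qed.

End charges_with_a_density.

Section polar_decomposition.
Context d (T : measurableType d) (R : realType) (nu : {charge set T -> \bar R}).

Definition total_variation : set T -> \bar R :=
  charge_variation (hahn_posneg nu).

HB.instance Definition _ := Measure.on total_variation.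

Let total_variation_fin : fin_num_fun total_variation.
Proof. by move=> A mA; rewrite fin_numD !fin_num_measure. Qed.

HB.instance Definition _ := @Measure_isFinite.Build _ T R
  total_variation total_variation_fin.

Lemma total_variation_pos B : measurable B -> B `<=` hahn_pos nu ->
  total_variation B = nu B.
Proof.
move=> mB BP; have [_ _ _ PN0] := hahn_posneg nu.
rewrite /total_variation /charge_variation /= jordan_posE jordan_negE.
rewrite cjordan_posE cjordan_negE /crestr0 mem_set// /crestr.
rewrite (_ : B `&` hahn_neg nu = set0) ?charge0 ?oppe0 ?adde0.
  by congr (nu _); apply/setIidPl.
by rewrite -subset0 => x [/BP Px Nx]; rewrite -PN0.
Qed.

Lemma total_variation_neg B : measurable B -> B `<=` hahn_neg nu ->
  total_variation B = (- nu B)%E.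
Proof.
move=> mB BN; have [_ _ _ PN0] := hahn_posneg nu.
rewrite /total_variation /charge_variation /= jordan_posE jordan_negE.
rewrite cjordan_posE cjordan_negE /crestr0 mem_set// /crestr.
rewrite (_ : B `&` hahn_pos nu = set0) ?charge0 ?add0e.
  by congr (- nu _)%E; apply/setIidPl.
by rewrite -subset0 => x [/BN Nx Px]; rewrite -PN0.
Qed.

(** The density is the sign, 1 on the positive set and -1 on the negative one;
    it is cut off outside [U], which [nu] does not charge. *)
Lemma polar_decomposition U : measurable U -> concentrated nu U ->
  exists (la : {sigma_finite_measure set T -> \bar R}) h,
    has_density nu la h /\ forall x, ~ U x -> h x = 0.
Proof.
move=> mU cU; have [[mP _] [mN _] PN PN0] := hahn_posneg nu.
have mPU : measurable (hahn_pos nu `&` U) by exact: measurableI.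
have mNU : measurable (hahn_neg nu `&` U) by exact: measurableI.
exists total_variation.
exists (fun x => \1_(hahn_pos nu `&` U) x - \1_(hahn_neg nu `&` U) x); split.
  have indic_fin B A : measurable B -> measurable A ->
      (total_variation : {measure set _ -> \bar R}).-integrable A (EFin \o \1_B).
    by move=> mB mA; apply: (integrableS measurableT) => //; exact: integrable_indic.
  split; first by apply: (integrableB _ (indic_fin _ _ mPU _) (indic_fin _ _ mNU _)).
  move=> A mA; under eq_integral do rewrite EFinB.
  rewrite integralB_EFin//; [|exact: indic_fin..].
  rewrite !integral_indic// (chargeDI nu mA mU).
  rewrite [X in (X + _)%E]cU ?add0e; last 2 first.
  - exact: measurableD.
  - by rewrite setDE -setIA setICl setI0.
  have mAU : measurable (A `&` U) by exact: measurableI.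
  rewrite (charge_partition nu mAU mP mN)//.
  congr (_ + _)%E.
    rewrite -total_variation_pos; last 2 first.
    - exact: measurableI.
    - by move=> x [[]].
    by congr total_variation; apply/seteqP; split=> x /=; tauto.
  rewrite -[LHS]oppeK -total_variation_neg; last 2 first.
  - exact: measurableI.
  - by move=> x [[]].
  by congr (- total_variation _)%E; apply/seteqP; split=> x /=; tauto.
move=> x nUx; rewrite !indicE !memNset ?subrr//; by case.
Qed.

End polar_decomposition.

(** * Product measures on row vectors *)

Section Rintegral_Fubini.
Context d1 d2 (T1 : measurableType d1) (T2 : measurableType d2) (R : realType).
Variables (m1 : {sigma_finite_measure set T1 -> \bar R})
  (m2 : {sigma_finite_measure set T2 -> \bar R}).

(** An integrable extended-real function is finite almost everywhere. *)
Lemma fine_integral_ae d (T : measurableType d)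
    (m : {measure set T -> \bar R}) (F : T -> \bar R) :
  m.-integrable setT F -> \int[m]_x (fine (F x)) = fine (\int[m]_x F x)%E.
Proof.
move=> iF; have mF := measurable_int _ iF.
congr fine; apply: ae_eq_integral => //.
  by apply/measurable_EFinP; exact: measurableT_comp.
by apply: filterS (integrable_ae measurableT iF) => x /= /(_ I) ? _; rewrite fineK.
Qed.

Lemma Rintegral_prod12 (g : T1 * T2 -> R) :
  (m1 \x m2)%E.-integrable setT (EFin \o g) ->
  \int[(m1 \x m2)%E]_z g z = \int[m1]_x \int[m2]_y g (x, y).
Proof.
move=> ig; rewrite /Rintegral -(integral12_prod_meas1 ig).
exact: esym (fine_integral_ae (integrable_fubini_F ig)).
Qed.

Lemma integrable_fubini_G (f : T1 * T2 -> \bar R) :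
  (m1 \x m2)%E.-integrable setT f -> m2.-integrable setT (fubini_G m1 f).
Proof.
move=> intf; have mf := measurable_int _ intf.
have mG := measurable_fubini_G intf.
apply/integrableP; split=> //.
have foo := (integrable21ltyP m1 m2 mf).1 intf.
apply: (le_lt_trans _ foo).
apply: ge0_le_integral => //.
- exact: measurableT_comp.
- apply: (measurable_fun_fubini_tonelli_G (abse \o f)) => //=.
  exact: measurableT_comp.
- move=> y _; apply: le_abse_integral => //; exact: measurableT_comp.
Qed.

Lemma Rintegral_prod21 (g : T1 * T2 -> R) :
  (m1 \x m2)%E.-integrable setT (EFin \o g) ->
  \int[(m1 \x m2)%E]_z g z = \int[m2]_y \int[m1]_x g (x, y).
Proof.
move=> ig; rewrite /Rintegral -(integral21_prod_meas1 ig).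
exact: esym (fine_integral_ae (integrable_fubini_G ig)).
Qed.

Lemma integrable_prod_fun (g : T1 -> R) (h : T2 -> R) :
  m1.-integrable setT (EFin \o g) -> m2.-integrable setT (EFin \o h) ->
  (m1 \x m2)%E.-integrable setT (EFin \o (fun z => g z.1 * h z.2)).
Proof.
move=> ig ih.
have mg : measurable_fun setT g by apply/measurable_EFinP; exact: measurable_int ig.
have mh : measurable_fun setT h by apply/measurable_EFinP; exact: measurable_int ih.
apply/integrable12ltyP.
  by apply/measurable_EFinP; apply: measurable_funM => //;
    apply: measurableT_comp.
have hoo : (\int[m2]_y `|(h y)%:E| < +oo)%E by case/integrableP : ih.
have goo : (\int[m1]_x `|(g x)%:E| < +oo)%E by case/integrableP : ig.
have hfin : (\int[m2]_y `|(h y)%:E|)%E \is a fin_num.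
  by rewrite ge0_fin_numE// integral_ge0.
rewrite (_ : (\int[m1]_x _ = (\int[m1]_x `|(g x)%:E|) * (\int[m2]_y `|(h y)%:E|))%E).
  by rewrite lte_mul_pinfty// ?integral_ge0// ge0_fin_numE// integral_ge0.
rewrite -ge0_integralZr//; last 2 first.
- by apply/measurable_EFinP; exact: measurableT_comp.
- by rewrite integral_ge0.
apply: eq_integral => x _; rewrite -ge0_integralZl//; last first.
  by apply/measurable_EFinP; exact: measurableT_comp.
by apply: eq_integral => y _ /=; rewrite -EFinM normrM.
Qed.

End Rintegral_Fubini.

Section sigma_finite_measure_of_measure.
Context d (T : measurableType d) (R : realType) (m : {measure set T -> \bar R}).

(** An alias of [m] on which the proof of sigma-finiteness can be registered. *)
Definition with_sigma_finite (sm : sigma_finite setT m) : set T -> \bar R := m.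

HB.instance Definition _ (sm : sigma_finite setT m) :=
  Measure.on (with_sigma_finite sm).
HB.instance Definition _ (sm : sigma_finite setT m) :=
  Measure_isSigmaFinite.Build _ _ _ (with_sigma_finite sm) sm.

End sigma_finite_measure_of_measure.

Section product_measure_on_row_vectors.
Context {R : realType}.
Local Notation sfm := {sigma_finite_measure set (measurableTypeR R) -> \bar R}.

Definition tail_family n (X : Type) (la : 'I_n.+1 -> X) (j : 'I_n) : X :=
  la (lift ord0 j).

(** The same recursion as for [lebesgue_rV], with one measure per coordinate. *)
Fixpoint prod_rV n : ('I_n -> sfm) -> {measure set 'rV[R]_n -> \bar R} :=
  match n with
  | 0 => fun=> dirac (0 : 'rV[R]_0)
  | m.+1 => fun la =>
    measure_function_pushforward__canonical__measure_function_Measure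
      (prod_rV (tail_family la) \x la ord0)%E (measurable_rV_cons (n := m))
  end.

Lemma lebesgue_rVE n :
  lebesgue_rV n = prod_rV (fun=> @lebesgue_measure R) :> {measure set 'rV[R]_n -> \bar R}.
Proof. by elim: n => //= n ->. Qed.

Definition rV_uncons n (x : 'rV[R]_n.+1) : 'rV[R]_n * measurableTypeR R :=
  (\row_j x ord0 (lift ord0 j), x ord0 ord0).

Lemma rV_consK n : cancel (@rV_cons R n) (@rV_uncons n).
Proof.
move=> [x t]; rewrite /rV_uncons/rV_cons/=; congr pair.
  by apply/rowP => j; rewrite !mxE liftK.
by rewrite !mxE unlift_none.
Qed.

Lemma measurable_to_rV d (T : measurableType d) n (f : T -> 'rV[R]_n) :
  (forall i, measurable_fun setT (rV_coord i \o f)) -> measurable_fun setT f.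
Proof.
move=> coord.
have : g_sigma_preimage (fun i => rV_coord i \o f) `<=` measurable.
  apply: smallest_sub; first exact: sigma_algebra_measurable.
  rewrite -bigcup_seq; apply: bigcup_sub => i _ _ [B mB <-].
  exact: coord.
rewrite g_sigma_preimage_comp => sub _ A mA.
by apply: sub; exists A.
Qed.

Lemma measurable_rV_uncons n : measurable_fun setT (@rV_uncons n).
Proof.
apply: measurable_fun_pair; last exact: measurable_rV_coord.
apply: measurable_to_rV => i.
rewrite (_ : _ \o _ = rV_coord (lift ord0 i)); first exact: measurable_rV_coord.
by apply/funext => x; rewrite /rV_coord/= mxE.
Qed.

(** Exhausting sets are pulled back along the inverse of [rV_cons], the map
    along which the measure is pushed forward. *)
Lemma prod_rV_sigma_finite n (la : 'I_n -> sfm) :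
  sigma_finite setT (prod_rV la).
Proof.
elim: n la => [|n IHn] la /=.
  exists (fun=> setT); first by rewrite bigcup_const.
  by move=> _; split=> //=; rewrite diracT ltry.
have /sigma_finiteP[F [FT F_nd Foo]] := IHn (tail_family la).
have /sigma_finiteP[G [GT G_nd Goo]] := sigma_finiteT (la ord0).
exists (fun k => @rV_uncons n @^-1` (F k `*` G k)).
  rewrite -preimage_bigcup; apply/esym/seteqP; split=> // x _.
  have [k _ Fx] : (\bigcup_k F k) (rV_uncons x).1 by rewrite -FT.
  have [l _ Gx] : (\bigcup_l G l) (rV_uncons x).2 by rewrite -GT.
  exists (maxn k l) => //; split.
  - by move: Fx; exact/subsetPset/F_nd/leq_maxl.
  - by move: Gx; exact/subsetPset/G_nd/leq_maxr.
move=> k; have [mF Fk] := Foo k; have [mG Gk] := Goo k; split.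
  rewrite -[X in measurable X]setTI.
  by apply: measurable_rV_uncons => //; exact: measurableX.
rewrite /pushforward -comp_preimage.
rewrite (_ : _ \o _ = id) ?preimage_id; last exact/funext/rV_consK.
by rewrite product_measure1E// lte_mul_pinfty// ge0_fin_numE.
Qed.

Definition sprod_rV n (la : 'I_n -> sfm) :
    {sigma_finite_measure set 'rV[R]_n -> \bar R} :=
  with_sigma_finite (prod_rV_sigma_finite la).

Lemma integrable_prod_rVS n (la : 'I_n.+1 -> sfm) (g : 'rV[R]_n.+1 -> R) :
  measurable_fun setT g ->
  (sprod_rV (tail_family la) \x la ord0)%E.-integrable setT
    (EFin \o (g \o @rV_cons R n)) ->
  (prod_rV la).-integrable setT (EFin \o g).
Proof.
move=> mg ig; apply: integrable_pushforward => //.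
  exact: measurable_rV_cons.
exact/measurable_EFinP.
Qed.

Lemma Rintegral_prod_rVS n (la : 'I_n.+1 -> sfm) (g : 'rV[R]_n.+1 -> R) :
  measurable_fun setT g ->
  (sprod_rV (tail_family la) \x la ord0)%E.-integrable setT
    (EFin \o (g \o @rV_cons R n)) ->
  \int[prod_rV la]_x g x =
  \int[(sprod_rV (tail_family la) \x la ord0)%E]_z g (rV_cons z).
Proof.
move=> mg ig; congr fine; apply: integral_pushforward => //.
  exact: measurable_rV_cons.
exact/measurable_EFinP.
Qed.

Definition tensor_fun n (g : 'I_n -> R -> R) (x : 'rV[R]_n) : R :=
  \prod_(j < n) g j (x ord0 j).

Lemma tensor_fun_cons n (g : 'I_n.+1 -> R -> R) (z : 'rV[R]_n * measurableTypeR R) :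
  tensor_fun g (rV_cons z) = tensor_fun (tail_family g) z.1 * g ord0 z.2.
Proof.
rewrite /tensor_fun big_ord_recl mulrC mxE unlift_none; congr (_ * _).
by apply: eq_bigr => j _; rewrite mxE liftK.
Qed.

Lemma measurable_tensor_fun n (g : 'I_n -> R -> R) :
  (forall j, measurable_fun setT (g j : measurableTypeR R -> R)) ->
  measurable_fun setT (tensor_fun g).
Proof.
move=> mg; apply: measurable_prod => j _.
apply: (measurableT_comp (mg j)); exact: measurable_rV_coord.
Qed.

Lemma integrable_tensor_fun n (la : 'I_n -> sfm) (g : 'I_n -> R -> R) :
  (forall j, (la j).-integrable setT (EFin \o g j)) ->
  (prod_rV la).-integrable setT (EFin \o tensor_fun g).
Proof.
elim: n la g => [|n IHn] la g ig;
  have mg j : measurable_fun setT (g j : measurableTypeR R -> R)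
    by apply/measurable_EFinP; exact: measurable_int (ig j).
  have mgE : measurable_fun setT (EFin \o tensor_fun g).
    by apply/measurable_EFinP; exact: measurable_tensor_fun.
  apply/integrableP; split=> //.
  rewrite integral_dirac// ?diracT ?mul1e ?ltry//.
  exact: measurableT_comp.
apply: integrable_prod_rVS; first exact: measurable_tensor_fun.
rewrite (_ : _ \o _ = EFin \o (fun z => tensor_fun (tail_family g) z.1 * g ord0 z.2)).
  by apply: integrable_prod_fun => //; apply: IHn => j; exact: ig.
by apply/funext => z /=; rewrite tensor_fun_cons.
Qed.

Lemma Rintegral_tensor_fun n (la : 'I_n -> sfm) (g : 'I_n -> R -> R) :
  (forall j, (la j).-integrable setT (EFin \o g j)) ->
  \int[prod_rV la]_x tensor_fun g x = \prod_(j < n) \int[la j]_t g j t.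
Proof.
elim: n la g => [|n IHn] la g ig;
  have mg j : measurable_fun setT (g j : measurableTypeR R -> R)
    by apply/measurable_EFinP; exact: measurable_int (ig j).
  rewrite big_ord0 /Rintegral integral_dirac//.
    by rewrite diracT mul1e /tensor_fun big_ord0.
  by apply/measurable_EFinP; exact: measurable_tensor_fun.
have ig' : (sprod_rV (tail_family la) \x la ord0)%E.-integrable setT
    (EFin \o (tensor_fun g \o @rV_cons R n)).
  rewrite (_ : _ \o _ = EFin \o (fun z => tensor_fun (tail_family g) z.1 * g ord0 z.2)).
    by apply: integrable_prod_fun => //; apply: integrable_tensor_fun => j; exact: ig.
  by apply/funext => z /=; rewrite tensor_fun_cons.
rewrite Rintegral_prod_rVS//; last exact: measurable_tensor_fun.
rewrite Rintegral_prod12//.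
transitivity (\int[sprod_rV (tail_family la)]_x
    (tensor_fun (tail_family g) x * \int[la ord0]_t g ord0 t)).
  apply: eq_Rintegral => x _; rewrite -RintegralZl//; last exact: ig.
  by apply: eq_Rintegral => t _; rewrite tensor_fun_cons.
rewrite [LHS](@RintegralZr _ _ _ (prod_rV (tail_family la)))//; last first.
  by apply: integrable_tensor_fun => j; exact: ig.
by rewrite big_ord_recl mulrC -IHn// => j; exact: ig.
Qed.

End product_measure_on_row_vectors.

(** * Topology of row vectors *)

Section topology_of_row_vectors.
Context {R : realType}.

Lemma ball_rV n (x y : 'rV[R]_n) e : 0 < e ->
  (forall j, `|x ord0 j - y ord0 j| < e) -> ball x e y.
Proof. by move=> e0 xy; split=> // i j; rewrite ord1; exact: xy. Qed.

(** An open set is the union of the rectangles with rational vertices that it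
    contains, and there are countably many of them. *)
Lemma open_rV_measurable n (U : set 'rV[R]_n) : open U -> measurable U.
Proof.
move=> oU.
pose Q : set ('rV[rat]_n * 'rV[rat]_n) :=
  [set p : 'rV[rat]_n * 'rV[rat]_n |
    rect (fun j => `]ratr (p.1 ord0 j), ratr (p.2 ord0 j)[%classic : set R)
      `<=` U].
pose F (p : 'rV[rat]_n * 'rV[rat]_n) : set 'rV[R]_n :=
  if p \in Q then rect (fun j => `]ratr (p.1 ord0 j), ratr (p.2 ord0 j)[%classic)
  else set0.
rewrite (_ : U = \bigcup_p F p).
  apply: countable_bigcupT_measurable; first exact: countableP.
  move=> p; rewrite /F; case: ifPn => // _; apply: measurable_rect => j.
  exact: measurable_itv.
apply/seteqP; split=> [x Ux|x [p _]]; last first.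
  by rewrite /F; case: ifPn => // /[!inE] + Fx; exact.
have /nbhs_ballP[e /= e0 xeU] := open_nbhs_nbhs (conj oU Ux).
have ratl j : exists q : rat, x ord0 j - e < ratr q < x ord0 j.
  have /rat_in_itvoo[q] : x ord0 j - e < x ord0 j by rewrite ltrBlDr ltrDl.
  by rewrite in_itv /= => ?; exists q.
have ratr' j : exists q : rat, x ord0 j < ratr q < x ord0 j + e.
  have /rat_in_itvoo[q] : x ord0 j < x ord0 j + e by rewrite ltrDl.
  by rewrite in_itv /= => ?; exists q.
have [q qP] := choice ratl; have [r rP] := choice ratr'.
exists (\row_j q j, \row_j r j) => //.
rewrite /F ifT.
  by move=> j /=; rewrite !mxE in_itv/=; move: (qP j) (rP j) => /andP[_ ->] /andP[->].
rewrite inE => y /= yqr; apply: xeU; apply: ball_rV => // j.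
move: (qP j) (rP j) (yqr j) => /andP[q1 q2] /andP[r1 r2] /=.
rewrite !mxE in_itv /= => /andP[y1 y2].
rewrite ltr_norml; apply/andP; split; lra.
Qed.

Lemma continuous_rV_measurable n (g : 'rV[R]_n -> R) : continuous g ->
  measurable_fun setT g.
Proof.
move=> cg; apply: (measurability _ (RGenOpens.measurableE R)).
move=> _ [_ [a [b ->] <-]]; rewrite setTI; apply: open_rV_measurable.
by apply: open_comp => [x _|]; [exact: cg|exact: interval_open].
Qed.

Lemma open_rect n (A : 'I_n -> set R) : (forall j, open (A j)) -> open (rect A).
Proof.
move=> oA; rewrite openE => x Ax.
exists (fun _ j => A j).
  by move=> i j; rewrite ord1; exact: open_nbhs_nbhs (conj (oA j) (Ax j)).
by move=> y /= yA j; exact: yA.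
Qed.

Variables (n : nat) (a b : 'I_n -> R).

Lemma interior_box : (box a b)° = rect (fun j => `]a j, b j[%classic).
Proof.
apply/seteqP; split=> [x /nbhs_ballP[e /= e0 xe] j /=|].
  have box_shift s : `|s| < e -> a j <= x ord0 j + s <= b j.
    move=> se; have /xe : ball x e (x + s *: delta_mx ord0 j).
      apply: ball_rV => // k; rewrite !mxE opprD addrA subrr sub0r normrN.
      by rewrite eqxx /=; case: (k == j); rewrite ?mulr0 ?mulr1 ?normr0.
    by move=> /(_ j); rewrite /= in_itv /= !mxE !eqxx mulr1.
  have e2 : 0 < e / 2 by rewrite divr_gt0.
  have e2e : e / 2 < e by rewrite ltr_pdivrMr// ltr_pMr// ltr1n.
  have := box_shift (e / 2); rewrite gtr0_norm// => /(_ e2e).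
  have := box_shift (- (e / 2)); rewrite normrN gtr0_norm// => /(_ e2e).
  by rewrite in_itv /= => /andP[p _] /andP[_ q]; apply/andP; split; lra.
have oI : open (rect (fun j => `]a j, b j[%classic)).
  by apply: open_rect => j; exact: interval_open.
move=> x Ix; rewrite /interior; apply: filterS (open_nbhs_nbhs (conj oI Ix)).
by move=> y yI j; have := yI j; rewrite /= !in_itv /= => /andP[/ltW -> /ltW ->].
Qed.

Lemma compact_box : compact (box a b).
Proof.
apply: (rV_compact (A := fun j => `[a j, b j]%classic)) => j.
exact: segment_compact.
Qed.

End topology_of_row_vectors.

(** * Sections and supports of test functions *)

Section partial_derivatives.
Context {R : realType}.

Definition supported_in n (K : set 'rV[R]_n) (g : 'rV[R]_n -> R) :=
  forall x, ~ K x -> g x = 0.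

Lemma smooth_partials n (g : 'rV[R]_n -> R) s :
  smooth g -> smooth (partials s g).
Proof. by move=> sg r; rewrite /partials -foldr_cat; exact: sg. Qed.

Lemma supported_in_partials n (K : set 'rV[R]_n) (g : 'rV[R]_n -> R) s :
  closed K -> supported_in K g -> supported_in K (partials s g).
Proof.
move=> cK Kg; elim: s => //= i s IHs x nKx.
rewrite /partial (@near_eq_derive _ _ _ _ (cst 0)) ?derive_cst//.
have oK : open (~` K) by exact: closed_openC.
by apply: filterS (open_nbhs_nbhs (conj oK nKx)) => y; exact: IHs.
Qed.

Lemma rV_cons_addS n (x : 'rV[R]_n) (t h : R) i :
  rV_cons (h *: delta_mx ord0 i + x, t : measurableTypeR R) =
  h *: delta_mx ord0 (lift ord0 i) + rV_cons (x, t : measurableTypeR R).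
Proof.
apply/rowP => j; rewrite !mxE eqxx /=.
case: (unliftP ord0 j) => [k ->|->].
  by rewrite !mxE eqxx (inj_eq lift_inj).
by rewrite (negbTE (neq_lift _ _)) mulr0 add0r.
Qed.

Lemma rV_cons_add0 n (x : 'rV[R]_n) (t h : R) :
  rV_cons (x, (h + t : R) : measurableTypeR R) =
  h *: delta_mx ord0 ord0 + rV_cons (x, t : measurableTypeR R).
Proof.
apply/rowP => j; rewrite !mxE eqxx /=.
case: (unliftP ord0 j) => [k ->|->]; last by rewrite eqxx mulr1.
by rewrite eq_sym (negbTE (neq_lift _ _)) mulr0 add0r.
Qed.

Definition tail_section n (g : 'rV[R]_n.+1 -> R) (t : R) (x : 'rV[R]_n) : R :=
  g (rV_cons (x, t : measurableTypeR R)).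

Definition head_section n (g : 'rV[R]_n.+1 -> R) (x : 'rV[R]_n) (t : R) : R :=
  g (rV_cons (x, t : measurableTypeR R)).

(** Freezing the first coordinate does not change the difference quotients in
    the other directions, hence neither derivability nor the derivatives; the
    next lemma is the analogue for the first direction. *)
Lemma tail_section_quotient n (g : 'rV[R]_n.+1 -> R) t i x :
  (fun h => h^-1 *: ((tail_section g t \o shift x) (h *: delta_mx ord0 i) -
    tail_section g t x)) =
  (fun h => h^-1 *: ((g \o shift (rV_cons (x, t : measurableTypeR R)))
    (h *: delta_mx ord0 (lift ord0 i)) - g (rV_cons (x, t : measurableTypeR R)))).
Proof. by apply/funext => h; rewrite /tail_section /= rV_cons_addS. Qed.

Lemma head_section_quotient n (g : 'rV[R]_n.+1 -> R) x t :
  (fun h => h^-1 *: ((head_section g x \o shift t) (h *: 1) -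
    head_section g x t)) =
  (fun h => h^-1 *: ((g \o shift (rV_cons (x, t : measurableTypeR R)))
    (h *: delta_mx ord0 ord0) - g (rV_cons (x, t : measurableTypeR R)))).
Proof.
by apply/funext => h; rewrite /head_section /= [h%:A]mulr1 rV_cons_add0.
Qed.

Lemma partials_tail_section n (g : 'rV[R]_n.+1 -> R) t s :
  partials s (tail_section g t) =
  tail_section (partials (map (lift ord0) s) g) t.
Proof.
elim: s => //= i s ->; apply/funext => x.
by rewrite /partial /derive tail_section_quotient.
Qed.

Lemma derive1_head_section n (g : 'rV[R]_n.+1 -> R) x :
  derive1 (head_section g x) = head_section (partial ord0 g) x.
Proof.
by apply/funext => t; rewrite derive1E /derive head_section_quotient.
Qed.

Lemma derive1n_head_section n (g : 'rV[R]_n.+1 -> R) x m :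
  derive1n m (head_section g x) = head_section (partials (nseq m ord0) g) x.
Proof. by elim: m => //= m ->; rewrite derive1_head_section. Qed.

Lemma continuous_to_rV (T : topologicalType) n (f : T -> 'rV[R]_n) :
  (forall i, continuous (fun x => f x ord0 i)) -> continuous f.
Proof.
move=> cf x A [P Px PA].
apply: (@filterS _ _ _ (fun y => forall i, P ord0 i (f y ord0 i))).
  by move=> y Py; apply: PA => i j; rewrite ord1.
by apply: filter_forall => i; exact: cf (Px ord0 i).
Qed.

Lemma continuous_rV_consl n (t : R) :
  continuous (fun x : 'rV[R]_n => rV_cons (x, t : measurableTypeR R)).
Proof.
apply: continuous_to_rV => i; case: (unliftP ord0 i) => [j ->|->].
  rewrite (_ : (fun _ => _) = (fun x : 'rV[R]_n => x ord0 j)).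
    exact: coord_continuous.
  by apply/funext => x; rewrite mxE liftK.
rewrite (_ : (fun _ => _) = cst t); first exact: cst_continuous.
by apply/funext => x; rewrite mxE unlift_none.
Qed.

Lemma continuous_rV_consr n (x : 'rV[R]_n) :
  continuous (fun t : R => rV_cons (x, t : measurableTypeR R)).
Proof.
apply: continuous_to_rV => i; case: (unliftP ord0 i) => [j ->|->].
  rewrite (_ : (fun _ => _) = cst (x ord0 j)); first exact: cst_continuous.
  by apply/funext => t; rewrite mxE liftK.
rewrite (_ : (fun _ => _) = id); first by move=> ?; exact: cvg_id.
by apply/funext => t; rewrite mxE unlift_none.
Qed.

Lemma smooth_tail_section n (g : 'rV[R]_n.+1 -> R) t :
  smooth g -> smooth (tail_section g t).
Proof.
move=> sg s; rewrite partials_tail_section.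
have [cg dg] := sg (map (lift ord0) s); split.
  move=> x; apply: (@continuous_comp _ _ _
    (fun y : 'rV[R]_n => rV_cons (y, t : measurableTypeR R))).
    exact: continuous_rV_consl.
  exact: cg.
by move=> i x; rewrite /derivable tail_section_quotient; exact: dg.
Qed.

Lemma derivable_head_section n (g : 'rV[R]_n.+1 -> R) x m t :
  smooth g -> derivable (derive1n m (head_section g x)) t 1.
Proof.
move=> sg; rewrite derive1n_head_section /derivable head_section_quotient.
by have [_ dg] := sg (nseq m ord0); exact: dg.
Qed.

End partial_derivatives.

Section test_functions.
Context {R : realType}.

Lemma rect_cons n (A : 'I_n.+1 -> set R) x (t : R) :
  rect A (rV_cons (x, t : measurableTypeR R)) <-> rect (tail_family A) x /\ A ord0 t.
Proof.
split=> [xtA|[xA tA] j].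
  split=> [j|]; first by have := xtA (lift ord0 j); rewrite mxE liftK.
  by have := xtA ord0; rewrite mxE unlift_none.
by case: (unliftP ord0 j) => [k ->|->]; rewrite mxE ?liftK ?unlift_none//; exact: xA.
Qed.

Lemma interior_box_cons n (a b : 'I_n.+1 -> R) x (t : R) :
  (box a b)° (rV_cons (x, t : measurableTypeR R)) <->
  (box (tail_family a) (tail_family b))° x /\ `]a ord0, b ord0[%classic t.
Proof. by rewrite !interior_box rect_cons. Qed.

(** The support condition in [test_fun] in the form in which it is used. *)
Lemma test_funP n (a b : 'I_n -> R) (g : 'rV[R]_n -> R) :
  test_fun a b g <->
  smooth g /\ exists K, [/\ closed K, K `<=` (box a b)° & supported_in K g].
Proof.
split=> [[sg _ Kb]|[sg [K [cK Kb gK]]]].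
  split=> //; exists (closure [set x | g x != 0]); split=> //.
    exact: closed_closure.
  move=> x; apply: contra_notP => /eqP gx; exact: subset_closure.
have gKs : closure [set x | g x != 0] `<=` K.
  rewrite [X in _ `<=` X](closure_id K).1//; apply: closureS => x /= gx.
  by apply: contrapT => /gK; exact/eqP.
split=> //; last exact: subset_trans gKs Kb.
apply: (subclosed_compact _ (@compact_box _ _ a b)).
  exact: closed_closure.
apply: subset_trans gKs _; apply: subset_trans Kb _.
exact: interior_subset.
Qed.

Lemma test_fun_partials n (a b : 'I_n -> R) g s :
  test_fun a b g -> test_fun a b (partials s g).
Proof.
move=> /test_funP[sg [K [cK Kb gK]]]; apply/test_funP; split.
  exact: smooth_partials.
by exists K; split=> //; exact: supported_in_partials.
Qed.

Lemma test_fun_tail_section n (a b : 'I_n.+1 -> R) g (t : R) :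
  test_fun a b g ->
  test_fun (tail_family a) (tail_family b) (tail_section g t).
Proof.
move=> /test_funP[sg [K [cK Kb gK]]]; apply/test_funP; split.
  exact: smooth_tail_section.
exists ((fun x => rV_cons (x, t : measurableTypeR R)) @^-1` K); split.
- by apply: preimage_closed => // x _; exact: continuous_rV_consl.
- by move=> x /= /Kb /interior_box_cons[].
- by move=> x /= nKx; exact: gK.
Qed.

Lemma test_fun1_head_section n (a b : 'I_n.+1 -> R) g x :
  test_fun a b g -> test_fun1 (a ord0) (b ord0) (head_section g x).
Proof.
move=> /test_funP[sg [K [cK Kb gK]]].
pose L := (fun t : R => rV_cons (x, t : measurableTypeR R)) @^-1` K.
have cL : closed L by apply: preimage_closed => // t _; exact: continuous_rV_consr.
have Lab : L `<=` `]a ord0, b ord0[%classic by move=> t /= /Kb /interior_box_cons[].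
have gL : closure [set t | head_section g x t != 0] `<=` L.
  rewrite [X in _ `<=` X](closure_id L).1//; apply: closureS => t /= gt.
  by apply: contrapT => /gK; exact/eqP.
split.
- by move=> m t; exact: derivable_head_section.
- apply: (subclosed_compact _ (@segment_compact _ (a ord0) (b ord0))).
    exact: closed_closure.
  by apply: subset_trans gL _; apply: subset_trans Lab _; exact: subset_itv_oo_cc.
- exact: subset_trans gL Lab.
Qed.

Lemma test_fun_bounded_measurable n (a b : 'I_n -> R) g :
  test_fun a b g -> bounded_measurable g.
Proof.
move=> /test_funP[sg [K [cK Kb gK]]]; have [/= cg _] := sg [::].
split; first exact: continuous_rV_measurable.
have : compact (g @` box a b).
  apply: continuous_compact; last exact: compact_box.
  exact: continuous_subspaceT.
move=> /compact_bounded/ex_strict_bound_gt0[M M0 gM].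
exists M => x; have [Kx|/gK ->] := pselect (K x); last by rewrite normr0 ltW.
by apply/ltW/(gM (g x)); exists x => //; apply: interior_subset; exact: Kb.
Qed.

End test_functions.

(** * Integration by parts for product functions *)

Section integration_by_parts.
Context {R : realType}.
Local Notation sfm := {sigma_finite_measure set (measurableTypeR R) -> \bar R}.
Local Notation leb := (@lebesgue_measure R).

Lemma bounded_measurable_comp d d' (T : measurableType d)
    (T' : measurableType d') (f : T -> T') (g : T' -> R) :
  measurable_fun setT f -> bounded_measurable g -> bounded_measurable (g \o f).
Proof.
move=> mf [mg [M gM]]; split; first exact: measurableT_comp.
by exists M => x; exact: gM.
Qed.

Lemma integrable_scale d (T : measurableType d)
    (m : {measure set T -> \bar R}) (c : R) (k : T -> R) :
  m.-integrable setT (EFin \o k) ->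
  m.-integrable setT (EFin \o (fun x => c * k x)).
Proof.
by move=> ik; apply: (@integrableZl _ _ _ m setT measurableT c (EFin \o k)).
Qed.

Lemma bounded_measurable_head_section n (g : 'rV[R]_n.+1 -> R) x :
  bounded_measurable g ->
  bounded_measurable (head_section g x : measurableTypeR R -> R).
Proof.
move=> bg; apply: (bounded_measurable_comp (f := fun t => rV_cons (x, t))) bg.
apply: measurableT_comp; [exact: measurable_rV_cons|exact: pair1_measurable].
Qed.

(** One coordinate at a time. For a fixed first coordinate the section of [zeta]
    is a test function, to which the induction hypothesis applies; after an
    exchange of the integrals, the hypothesis on the first factor applies to the
    sections in the first variable of the partial derivative obtained. Since the
    first coordinate comes first in [enum], the derivative along it is the last
    one taken, and partial derivatives never have to be exchanged. *)
Lemma tensor_fun_integration_by_parts n (a b : 'I_n -> R) (la : 'I_n -> sfm)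
    (h g : 'I_n -> R -> R) (I : 'I_n -> bool) :
  (forall j, (la j).-integrable setT (EFin \o h j)) ->
  (forall j, leb.-integrable setT (EFin \o g j)) ->
  (forall j zeta, test_fun1 (a j) (b j) zeta ->
    \int[la j]_t (zeta t * h j t) =
    if I j then - \int[leb]_t (g j t * derive1 zeta t)
    else \int[leb]_t (g j t * zeta t)) ->
  forall zeta, test_fun a b zeta ->
    \int[prod_rV la]_x (zeta x * tensor_fun h x) =
    (-1) ^+ count I (enum 'I_n) *
    \int[prod_rV (fun=> leb)]_x
      (tensor_fun g x * partials [seq j <- enum 'I_n | I j] zeta x).
Proof.
elim: n a b la h g I => [|n IHn] a b la h g I ih ig hg zeta tz.
  rewrite (size0nil (size_enum_ord 0)) /= mul1r; apply: eq_Rintegral => x _.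
  by rewrite /tensor_fun !big_ord0 mulr1 mul1r.
pose s := [seq j <- enum 'I_n | tail_family I j].
pose c : R := (-1) ^+ count (tail_family I) (enum 'I_n).
pose G := partials (map (lift ord0) s) zeta.
pose m := sprod_rV (tail_family la).
pose l := sprod_rV (fun _ : 'I_n => leb).
have tG : test_fun a b G by exact: test_fun_partials.
have ih' : m.-integrable setT (EFin \o tensor_fun (tail_family h)).
  by apply: integrable_tensor_fun => j; exact: ih.
have ig' : l.-integrable setT (EFin \o tensor_fun (tail_family g)).
  by apply: integrable_tensor_fun => j; exact: ig.
have bcons (k : 'rV[R]_n.+1 -> R) : bounded_measurable k ->
    bounded_measurable (k \o @rV_cons R n).
  by apply: bounded_measurable_comp; exact: measurable_rV_cons.
have mh j : measurable_fun setT (h j : measurableTypeR R -> R).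
  by apply/measurable_EFinP; exact: measurable_int (ih j).
have mg j : measurable_fun setT (g j : measurableTypeR R -> R).
  by apply/measurable_EFinP; exact: measurable_int (ig j).
have bz := test_fun_bounded_measurable tz.
have bG := test_fun_bounded_measurable tG.
have iz : (m \x la ord0)%E.-integrable setT
    (EFin \o ((fun x => zeta x * tensor_fun h x) \o @rV_cons R n)).
  rewrite (_ : _ \o _ = EFin \o (fun z => (zeta \o @rV_cons R n) z *
      (tensor_fun (tail_family h) z.1 * h ord0 z.2))).
    by apply: integrable_bounded_mul; [exact: bcons|exact: integrable_prod_fun].
  by apply/funext => z /=; rewrite tensor_fun_cons.
rewrite Rintegral_prod_rVS//; last first.
  by apply: measurable_funM; [exact: bz.1|exact: measurable_tensor_fun].
rewrite Rintegral_prod21//.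
pose K (z : 'rV[R]_n * measurableTypeR R) := c * ((G \o @rV_cons R n) z *
  (tensor_fun (tail_family g) z.1 * h ord0 z.2)).
have iK : (l \x la ord0)%E.-integrable setT (EFin \o K).
  apply: integrable_scale.
  by apply: integrable_bounded_mul; [exact: bcons|exact: integrable_prod_fun].
(* the induction hypothesis, for each value t of the first coordinate *)
transitivity (\int[la ord0]_t \int[l]_x K (x, t)).
  apply: eq_Rintegral => t _.
  transitivity (\int[m]_x (h ord0 t * (tail_section zeta t x *
      tensor_fun (tail_family h) x))).
    by apply: eq_Rintegral => x _; rewrite tensor_fun_cons /tail_section /=; ring.
  have tzt := test_fun_tail_section t tz.
  have tGt := test_fun_tail_section t tG.
  rewrite RintegralZl//; last first.
    by apply: integrable_bounded_mul => //; exact: test_fun_bounded_measurable tzt.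
  have -> : \int[m]_x (tail_section zeta t x * tensor_fun (tail_family h) x) =
      c * \int[l]_x (tensor_fun (tail_family g) x *
        partials s (tail_section zeta t) x).
    apply: (IHn _ _ _ _ _ (tail_family I) _ _ _ _ tzt).
    - by move=> j; exact: ih.
    - by move=> j; exact: ig.
    - by move=> j; exact: hg.
  rewrite partials_tail_section -/G mulrA -RintegralZl//; last first.
    rewrite (_ : EFin \o _ = EFin \o (fun x => tail_section G t x *
        tensor_fun (tail_family g) x)).
      by apply: integrable_bounded_mul => //; exact: test_fun_bounded_measurable tGt.
    by apply/funext => x /=; rewrite mulrC.
  by apply: eq_Rintegral => x _; rewrite /K /tail_section /=; ring.
rewrite -Rintegral_prod21// Rintegral_prod12//.
pose G' := partials [seq j <- enum 'I_n.+1 | I j] zeta.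
pose c' : R := (-1) ^+ count I (enum 'I_n.+1).
have tG' : test_fun a b G' by exact: test_fun_partials.
have bG' := test_fun_bounded_measurable tG'.
have G'E : G' = if I ord0 then partial ord0 G else G.
  by rewrite /G' enum_ordSl /= filter_map; case: (I ord0).
have c'E : c' = if I ord0 then - c else c.
  rewrite /c' enum_ordSl /= count_map -/c.
  by case: (I ord0); rewrite ?add1n ?exprS ?mulN1r.
pose K' (z : 'rV[R]_n * measurableTypeR R) := c' * ((G' \o @rV_cons R n) z *
  (tensor_fun (tail_family g) z.1 * g ord0 z.2)).
have iK' : (l \x leb)%E.-integrable setT (EFin \o K').
  apply: integrable_scale.
  by apply: integrable_bounded_mul; [exact: bcons|exact: integrable_prod_fun].
(* the hypothesis on the first factor, for each value x of the others *)
transitivity (\int[l]_x \int[leb]_t K' (x, t)).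
  apply: eq_Rintegral => x _.
  transitivity (\int[la ord0]_t (c * tensor_fun (tail_family g) x *
      (head_section G x t * h ord0 t))).
    by apply: eq_Rintegral => t _; rewrite /K /head_section /=; ring.
  rewrite RintegralZl//; last first.
    by apply: integrable_bounded_mul (ih ord0); exact: bounded_measurable_head_section.
  rewrite hg; last exact: test_fun1_head_section.
  transitivity (c' * tensor_fun (tail_family g) x *
    \int[leb]_t (head_section G' x t * g ord0 t)).
    rewrite c'E G'E; case: (I ord0).
      rewrite mulrN !mulNr derive1_head_section; congr (- (_ * _)).
      by apply: eq_Rintegral => t _; rewrite mulrC.
    by congr (_ * _); apply: eq_Rintegral => t _; rewrite mulrC.
  rewrite -RintegralZl//; last first.
    by apply: integrable_bounded_mul (ig ord0); exact: bounded_measurable_head_section.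
  by apply: eq_Rintegral => t _; rewrite /K' /head_section /=; ring.
rewrite -Rintegral_prod12// -RintegralZl//; last first.
  rewrite (_ : EFin \o _ = EFin \o (fun x => G' x * tensor_fun g x)).
    by apply: integrable_bounded_mul => //; exact: integrable_tensor_fun.
  by apply/funext => x /=; rewrite mulrC.
have KE : K' = (fun x => c' * (tensor_fun g x * G' x)) \o @rV_cons R n.
  by apply/funext => z; rewrite /K' /= tensor_fun_cons; ring.
rewrite Rintegral_prod_rVS//; last 2 first.
- apply: measurable_funM => //; apply: measurable_funM.
    exact: measurable_tensor_fun.
  exact: bG'.1.
- by move: iK'; rewrite KE.
by apply: eq_Rintegral => z _; rewrite KE.
Qed.

End integration_by_parts.

(** * Smooth cutoff functions *)

Section flat_functions.
Context {R : realType}.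

(** The derivatives of exp (- 1 / x), extended by zero, are combinations of the
    functions below. *)
Definition flat (k : nat) (x : R) : R :=
  if 0 < x then x^-1 ^+ k * expR (- x^-1) else 0.

Lemma flat_le0 k x : x <= 0 -> flat k x = 0.
Proof. by rewrite /flat ltNge => ->. Qed.

Lemma flat_ge0 k x : 0 <= flat k x.
Proof.
rewrite /flat; case: ifPn => // x0.
by rewrite mulr_ge0 ?expR_ge0// exprn_ge0// invr_ge0 ltW.
Qed.

Lemma flat0_gt0 x : (0 < flat 0 x) = (0 < x).
Proof. by rewrite /flat; case: ifPn; rewrite ?ltxx// expr0 mul1r expR_gt0. Qed.

Lemma flat0_lt1 x : flat 0 x < 1.
Proof.
rewrite /flat; case: ifPn; rewrite ?ltr01// => x0.
by rewrite expr0 mul1r expR_lt1 oppr_lt0 invr_gt0.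
Qed.

Lemma flat0_nondecreasing x y : x <= y -> flat 0 x <= flat 0 y.
Proof.
move=> xy; have [x0|/flat_le0 ->] := ltP 0 x; last exact: flat_ge0.
have y0 := lt_le_trans x0 xy.
by rewrite /flat x0 y0 !expr0 !mul1r ler_expR lerN2 lef_pV2.
Qed.

(** Keep one term of the exponential series: e^y >= y^(k+1) / (k+1)! at
    y = 1/x. *)
Lemma flat_bound k x : `|flat k x| <= k.+1`!%:R * `|x|.
Proof.
have [x0|x0] := ltP 0 x; last by rewrite flat_le0// normr0 mulr_ge0.
rewrite ger0_norm ?flat_ge0// gtr0_norm// /flat x0.
have y0 : 0 < x^-1 by rewrite invr_gt0.
have := expR_ge1Dxn k (ltW y0); set y := x^-1 in y0 *.
have f0 : 0 < k.+1`!%:R :> R by rewrite ltr0n fact_gt0.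
move=> ky; have {ky} : y ^+ k.+1 / k.+1`!%:R <= expR y.
  by apply: le_trans ky; rewrite lerDr.
rewrite ler_pdivrMr// mulrC => ky.
have xy : x * y = 1 by rewrite mulfV ?gt_eqF.
have -> : y ^+ k = y ^+ k.+1 * x by rewrite exprSr -mulrA [y * x]mulrC xy mulr1.
by rewrite expRN ler_pdivrMr ?expR_gt0// mulrAC ler_pM2r.
Qed.

Lemma flat_mulr k x : flat k x = flat k.+1 x * x.
Proof.
have [x0|x0] := ltP 0 x; last by rewrite !flat_le0 ?mul0r.
by rewrite /flat x0 mulrAC exprSr -(mulrA _ _ x) mulVf ?mulr1// gt_eqF.
Qed.

Lemma continuous_flat_0 k : {for 0, continuous (flat k)}.
Proof.
suff f0 : flat k x @[x --> (0 : R)] --> (0 : R).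
  by rewrite /prop_for /continuous_at flat_le0.
apply/cvgr0Pnorm_le => e e0; near=> x.
apply: le_trans (flat_bound k x) _.
rewrite -ler_pdivlMl ?ltr0n ?fact_gt0//; near: x.
apply/nbhs_ballP; exists ((k.+1)`!%:R^-1 * e) => /=.
  by rewrite mulr_gt0// invr_gt0 ltr0n fact_gt0.
by move=> y; rewrite /ball /= sub0r normrN => /ltW.
Unshelve. all: by end_near. Qed.

Lemma is_derive_flat (k : nat) (x : R) :
  is_derive x 1 (flat k) (flat k.+2 x - k%:R * flat k.+1 x).
Proof.
have [x0|x0|->] := ltgtP x 0.
- rewrite !(flat_le0 _ (ltW x0)) mulr0 subr0.
  apply: (@near_eq_is_derive _ _ _ (cst (0 : R))).
  near=> y; rewrite flat_le0//; apply/ltW; near: y.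
  exact: lt_nbhsl.
- apply: (@near_eq_is_derive _ _ _ (fun y : R => y^-1 ^+ k * expR (- y^-1) : R)).
    near=> y; rewrite /flat ifT//; near: y; exact: lt_nbhsr.
  have xn0 : x != 0 by rewrite gt_eqF.
  have dV : is_derive x (1 : R) (fun y => y^-1) (- x ^- 2).
    by have := @is_deriveV _ id x 1 1 xn0 (is_derive_id _ _); rewrite /= [_%:A]mulr1.
  have dE : is_derive x (1 : R) (fun y => expR (- y^-1))
      (expR (- x^-1) * (- - x ^- 2)).
    have dN : is_derive x (1 : R) (fun y => - y^-1) (- - x ^- 2) by exact: is_deriveN.
    exact: (@is_derive1_comp _ expR (fun y => - y^-1)).
  have := is_deriveM (is_deriveX k dV) dE; rewrite exprfctE => dM.
  apply: (is_derive_eq dM).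
  rewrite /flat x0 /GRing.scale /= opprK.
  rewrite -exprVn; case: k {dM} => [|k] /=; first by rewrite expr0 !expr2; ring.
  by rewrite !exprS; ring.
(* At 0, [flat k.+1] is the slope function of [flat k] and it is continuous. *)
- rewrite !flat_le0// mulr0 subr0; apply/is_derive1_caratheodory.
  exists (flat k.+1); split.
  + by move=> z; rewrite (flat_le0 k (lexx 0)) !subr0; exact: flat_mulr.
  + exact: continuous_flat_0.
  + by rewrite flat_le0.
Unshelve. all: by end_near. Qed.

Lemma continuous_flat k : continuous (flat k).
Proof.
move=> x; apply: differentiable_continuous; apply/derivable1_diffP.
by have [] := is_derive_flat k x.
Qed.

End flat_functions.

Section flat_algebra.
Context {R : realType} (n : nat).

(** An algebra of functions stable under partial derivatives, so that its
    elements are smooth, and rich enough to contain bump functions. *)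
Inductive flat_algebra : ('rV[R]_n -> R) -> Prop :=
| flat_algebra_cst c : flat_algebra (fun=> c)
| flat_algebra_coord i : flat_algebra (fun x => x ord0 i)
| flat_algebraD u v : flat_algebra u -> flat_algebra v ->
    flat_algebra (fun x => u x + v x)
| flat_algebraM u v : flat_algebra u -> flat_algebra v ->
    flat_algebra (fun x => u x * v x)
| flat_algebra_flat k u : flat_algebra u -> flat_algebra (fun x => flat k (u x)).

Lemma is_derive_lineP (f : 'rV[R]_n -> R) x v df :
  is_derive (0 : R) 1 (fun h : R => f (h *: v + x)) df <-> is_derive x v f df.
Proof.
have E : (fun h : R => h^-1 *: (((fun h : R => f (h *: v + x)) \o shift 0)
      (h *: 1) - f (0 *: v + x))) =
    (fun h => h^-1 *: ((f \o shift x) (h *: v) - f x)).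
  by apply/funext => h /=; rewrite addr0 scale0r add0r [h%:A]mulr1.
have dE : derivable (fun h : R => f (h *: v + x)) (0 : R) 1 = derivable f x v.
  by rewrite /derivable E.
have DE : 'D_1 (fun h : R => f (h *: v + x)) (0 : R) = 'D_v f x.
  by rewrite /derive E.
split=> -[d D]; constructor.
- by rewrite -dE.
- by rewrite -DE.
- by rewrite dE.
- by rewrite DE.
Qed.

Lemma flat_algebra_derive u i : flat_algebra u ->
  exists2 u', flat_algebra u' & forall x, is_derive x (delta_mx ord0 i) u (u' x).
Proof.
elim=> {u} [c|j|u v _ [u' Cu' du] _ [v' Cv' dv]|u v Cu [u' Cu' du] Cv [v' Cv' dv]
  |k u Cu [u' Cu' du]].
- by exists (fun=> 0); [exact: flat_algebra_cst|move=> x; exact: is_derive_cst].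
- exists (fun=> (j == i)%:R); first exact: flat_algebra_cst.
  move=> x; apply/is_derive_lineP.
  rewrite (_ : (fun _ => _) = (fun h : R => h * (j == i)%:R + x ord0 j)); last first.
    by apply/funext => h; rewrite !mxE eqxx.
  have d1 : is_derive (0 : R) 1 (fun h : R => (j == i)%:R *: h) (j == i)%:R.
    by apply: is_derive_eq; rewrite [_%:A]mulr1.
  have := is_deriveD d1 (is_derive_cst (x ord0 j) (0 : R) 1); rewrite addr0.
  congr is_derive; apply/funext => h /=.
  by rewrite mulrC.
- exists (fun x => u' x + v' x); first exact: flat_algebraD.
  by move=> x; exact: is_deriveD.
- exists (fun x => u x * v' x + v x * u' x).
    by apply: flat_algebraD; apply: flat_algebraM.
  by move=> x; exact: is_deriveM.
exists (fun x => (flat k.+2 (u x) + - k%:R * flat k.+1 (u x)) * u' x).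
  apply: flat_algebraM => //; apply: flat_algebraD; first exact: flat_algebra_flat.
  by apply: flat_algebraM; [exact: flat_algebra_cst|exact: flat_algebra_flat].
move=> x; apply/is_derive_lineP.
have du0 : is_derive (0 : R) 1 (fun h : R => u (h *: delta_mx ord0 i + x)) (u' x).
  by apply/is_derive_lineP; exact: du.
rewrite mulNr; apply: (@is_derive1_comp _ (flat k) _ 0).
by rewrite scale0r add0r; exact: is_derive_flat.
Qed.

Lemma flat_algebra_continuous u : flat_algebra u -> continuous u.
Proof.
elim=> {u} [c|j|u v _ cu _ cv|u v _ cu _ cv|k u _ cu] x.
- exact: cst_continuous.
- exact: coord_continuous.
- exact: (cvgD (cu x) (cv x)).
- exact: (cvgM (cu x) (cv x)).
- exact: (continuous_comp (cu x) (@continuous_flat _ k (u x))).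
Qed.

Lemma flat_algebra_partials u s : flat_algebra u -> flat_algebra (partials s u).
Proof.
move=> Cu; elim: s => //= i s /(flat_algebra_derive i)[u' Cu' du].
rewrite (_ : partial _ _ = u')//; apply/funext => x.
by case: (du x).
Qed.

Lemma flat_algebra_smooth u : flat_algebra u -> smooth u.
Proof.
move=> Cu s; have Cs := flat_algebra_partials s Cu; split.
  exact: flat_algebra_continuous.
move=> i x; have [u' _ du] := flat_algebra_derive i Cs.
by case: (du x).
Qed.

Lemma flat_algebra_exp u m : flat_algebra u -> flat_algebra (fun x => u x ^+ m).
Proof.
move=> Cu; elim: m => [|m IHm]; first exact: flat_algebra_cst.
rewrite (_ : (fun _ => _) = (fun x => u x * u x ^+ m)).
  exact: flat_algebraM.
by apply/funext => x; rewrite exprS.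
Qed.

Lemma flat_algebraB u v : flat_algebra u -> flat_algebra v ->
  flat_algebra (fun x => u x - v x).
Proof.
move=> Cu Cv; rewrite (_ : (fun _ => _) = (fun x => u x + -1 * v x)).
  by apply: flat_algebraD => //; apply: flat_algebraM => //; exact: flat_algebra_cst.
by apply/funext => x; rewrite mulN1r.
Qed.

Lemma flat_algebra_prod (I : Type) (r : seq I) (u : I -> 'rV[R]_n -> R) :
  (forall i, flat_algebra (u i)) -> flat_algebra (fun x => \prod_(i <- r) u i x).
Proof.
move=> Cu; elim: r => [|i r IHr].
  rewrite (_ : (fun _ => _) = (fun=> 1)); first exact: flat_algebra_cst.
  by apply/funext => x; rewrite big_nil.
rewrite (_ : (fun _ => _) = (fun x => u i x * \prod_(j <- r) u j x)).
  exact: flat_algebraM.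
by apply/funext => x; rewrite big_cons.
Qed.

Variables (a b : 'I_n -> R).

Definition box_bump (x : 'rV[R]_n) : R :=
  \prod_(j < n) (flat 0 (x ord0 j - a j) * flat 0 (b j - x ord0 j)).

Lemma flat_algebra_box_bump : flat_algebra box_bump.
Proof.
apply: flat_algebra_prod => j; apply: flat_algebraM; apply: flat_algebra_flat.
  by apply: flat_algebraB; [exact: flat_algebra_coord|exact: flat_algebra_cst].
by apply: flat_algebraB; [exact: flat_algebra_cst|exact: flat_algebra_coord].
Qed.

Lemma box_bump_gt0 x : 0 < box_bump x <-> (box a b)° x.
Proof.
rewrite interior_box; split=> [+ j /=|xab].
  rewrite lt_def => /andP[/prodf_neq0/(_ j isT) + _].
  rewrite mulf_eq0 negb_or => /andP[p q].
  have pa : 0 < x ord0 j - a j by rewrite -flat0_gt0 lt_neqAle eq_sym p flat_ge0.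
  have pb : 0 < b j - x ord0 j by rewrite -flat0_gt0 lt_neqAle eq_sym q flat_ge0.
  by rewrite in_itv /= -subr_gt0 pa /= -subr_gt0.
apply: prodr_gt0 => j _; move: (xab j); rewrite /= in_itv /= => /andP[p q].
by rewrite mulr_gt0// flat0_gt0 subr_gt0.
Qed.

(** The product w of the two flat functions is in [0, 1], vanishes where
    [box_bump x <= m.+1%:R^-1] or [u x <= 0], and is bounded away from 0 as m
    grows when x is in the open box and [0 < u x]; then 1 - (1 - w)^m tends to 1,
    while it is 0 when w is. *)
Definition cutoff (u : 'rV[R]_n -> R) (m : nat) (x : 'rV[R]_n) : R :=
  1 - (1 - flat 0 (u x) * flat 0 (box_bump x - m.+1%:R^-1)) ^+ m.

Lemma test_fun_cutoff u m : flat_algebra u -> test_fun a b (cutoff u m).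
Proof.
move=> Cu; apply/test_funP; split.
  apply: flat_algebra_smooth; apply: flat_algebraB; first exact: flat_algebra_cst.
  apply: flat_algebra_exp; apply: flat_algebraB; first exact: flat_algebra_cst.
  apply: flat_algebraM; apply: flat_algebra_flat => //.
  by apply: flat_algebraB; [exact: flat_algebra_box_bump|exact: flat_algebra_cst].
have m0 : 0 < m.+1%:R^-1 :> R by rewrite invr_gt0 ltr0n.
exists (box_bump @^-1` [set t | m.+1%:R^-1 <= t]); split.
- apply: preimage_closed; last exact: closed_ge.
  by move=> x _; apply: flat_algebra_continuous; exact: flat_algebra_box_bump.
- by move=> x /= mx; apply/box_bump_gt0; exact: lt_le_trans mx.
- move=> x /= /negP; rewrite -ltNge => xm.
  by rewrite /cutoff [flat 0 (_ - _)]flat_le0 ?subr_le0 ?ltW// mulr0 subr0 expr1n subrr.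
Qed.

Lemma cutoff_weight u m x :
  0 <= flat 0 (u x) * flat 0 (box_bump x - m.+1%:R^-1) <= 1.
Proof. by rewrite mulr_ge0 ?flat_ge0//= mulr_ile1 ?flat_ge0// ltW// flat0_lt1. Qed.

Lemma cutoff_bound u m x : 0 <= cutoff u m x <= 1.
Proof.
have /andP[w0 w1] := cutoff_weight u m x.
rewrite /cutoff subr_ge0 exprn_ile1 ?subr_ge0//=; last by rewrite gerBl.
by rewrite gerBl exprn_ge0// subr_ge0.
Qed.

Lemma cvg_cutoff u x : cutoff u m x @[m --> \oo] -->
  (\1_([set y | 0 < u y] `&` (box a b)°) x : R).
Proof.
rewrite indicE; case: (boolP (x \in _)); rewrite ?inE ?notin_setE /= => ux.
  case: ux => ux /box_bump_gt0 hx.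
  rewrite -[X in _ --> X](subr0 1); apply: cvgB; first exact: cvg_cst.
  have [N N1] : exists N : nat, N.+1%:R^-1 < box_bump x.
    have [N _ /(_ N (leqnn _)) /= hN] := near_infty_natSinv_lt (PosNum hx).
    by exists N.
  pose w := flat 0 (u x) * flat 0 (box_bump x - N.+1%:R^-1).
  have w0 : 0 < w by rewrite mulr_gt0 ?flat0_gt0 ?subr_gt0.
  have w1 : w <= 1 by have /andP[] := cutoff_weight u N x.
  apply: (@squeeze_cvgr _ _ _ _ (fun=> 0) (fun m => (1 - w) ^+ m)).
  - exists N => // m /= Nm.
    have /andP[_ v1] := cutoff_weight u m x.
    rewrite exprn_ge0 ?subr_ge0//= lerXn2r ?nnegrE ?subr_ge0// lerD2l lerN2.
    rewrite ler_wpM2l ?flat_ge0// flat0_nondecreasing// lerD2l lerN2.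
    by rewrite lef_pV2 ?posrE ?ltr0n// ler_nat ltnS.
  - exact: cvg_cst.
  - by apply: cvg_expr; rewrite ger0_norm ?subr_ge0// gtrBl.
rewrite (_ : (fun _ => _) = (fun=> 0)); first exact: cvg_cst.
apply/funext => m; rewrite /cutoff.
suff -> : flat 0 (u x) * flat 0 (box_bump x - m.+1%:R^-1) = 0.
  by rewrite subr0 expr1n subrr.
have [u0|/flat_le0 ->] := ltP 0 (u x); last by rewrite mul0r.
rewrite [X in _ * X]flat_le0 ?mulr0// subr_le0.
have [b0|b0] := ltP 0 (box_bump x).
  by exfalso; apply: ux; split=> //; exact/box_bump_gt0.
by apply: le_trans b0 _; rewrite invr_ge0.
Qed.

End flat_algebra.

(** * A charge is determined by its integrals of test functions *)

Section uniqueness.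
Context {R : realType} (n : nat).

Lemma cvg_Rintegral_indic d (T : measurableType d)
    (m : {finite_measure set T -> \bar R}) (A : set T) (z : nat -> T -> R) :
  measurable A -> (forall k, measurable_fun setT (z k)) ->
  (forall k x, 0 <= z k x <= 1) ->
  (forall x, z k x @[k --> \oo] --> (\1_A x : R)) ->
  \int[m]_x z k x @[k --> \oo] --> fine (m A).
Proof.
move=> mA mz z01 zA.
have mA1 : measurable_fun setT (EFin \o (\1_A : T -> R)) by exact/measurable_EFinP.
have [] := @dominated_convergence _ _ _ m setT measurableT
  (fun k => EFin \o z k) (EFin \o \1_A) (cst 1%E).
- by move=> k; apply/measurable_EFinP.
- by [].
- by apply: aeW => x _; apply: cvg_EFin; [exact: nearW|exact: zA].
- exact: finite_measure_integrable_cst.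
- apply: aeW => x k _ /=; rewrite lee_fin.
  by have /andP[z0 z1] := z01 k x; rewrite ger0_norm.
move=> _ _; rewrite integral_indic// setIT => zm.
apply: fine_cvg; rewrite fineK; last exact: fin_num_measure.
exact: zm.
Qed.

Lemma cvg_charge_integral_indic d (T : measurableType d)
    (nu : {charge set T -> \bar R}) (A : set T) (z : nat -> T -> R) :
  measurable A -> (forall k, measurable_fun setT (z k)) ->
  (forall k x, 0 <= z k x <= 1) ->
  (forall x, z k x @[k --> \oo] --> (\1_A x : R)) ->
  charge_integral nu (z k) @[k --> \oo] --> fine (nu A).
Proof.
move=> mA mz z01 zA.
rewrite (jordan_decomp (hahn_posneg nu) mA) /cadd /= cscaleN1.
rewrite fineB; [|exact: fin_num_measure..].
by apply: cvgB; exact: cvg_Rintegral_indic.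
Qed.

Lemma flat_algebra_measurable (u : 'rV[R]_n -> R) : flat_algebra u ->
  measurable [set x | 0 < u x].
Proof.
move=> Cu; apply: open_rV_measurable.
rewrite (_ : [set x | _] = u @^-1` [set t | 0 < t])//.
apply: open_comp; last exact: open_gt.
by move=> x _; exact: flat_algebra_continuous.
Qed.

Definition positivity_sets : set (set 'rV[R]_n) :=
  [set A | exists2 u, flat_algebra u & A = [set x | 0 < u x]].

(** Products of the algebra give intersections; this is why the sets
    [[set x | 0 < u x]] are used as the pi-system. *)
Lemma setI_positivity_sets : setI_closed positivity_sets.
Proof.
move=> _ _ [u Cu ->] [v Cv ->].
exists (fun x => flat 0 (u x) * flat 0 (v x)).
  by apply: flat_algebraM; exact: flat_algebra_flat.
apply/seteqP; split=> [x [/= ux vx]|x /=].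
  by rewrite mulr_gt0// flat0_gt0.
have [u0|/flat_le0 ->] := ltP 0 (u x); last by rewrite mul0r ltxx.
have [v0|/flat_le0 ->] := ltP 0 (v x); last by rewrite mulr0 ltxx.
by [].
Qed.

(** Already the half-spaces, where a coordinate exceeds a constant, generate. *)
Lemma measurable_positivity_sets : measurable = <<s positivity_sets >>.
Proof.
apply/seteqP; split; last first.
  apply: smallest_sub; first exact: sigma_algebra_measurable.
  by move=> _ [u Cu ->]; exact: flat_algebra_measurable.
apply: smallest_sub; first exact: smallest_sigma_algebra.
rewrite -bigcup_seq; apply: bigcup_sub => i _ _ [B mB <-].
have : measurable_fun (setT : set (g_sigma_algebraType positivity_sets))
    (rV_coord i : g_sigma_algebraType positivity_sets -> measurableTypeR R).
  apply: (measurability _ (RGenOInfty.measurableE R)).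
  move=> _ [_ [x ->] <-]; rewrite setTI; apply: sub_sigma_algebra.
  exists (fun y : 'rV[R]_n => y ord0 i - x).
    by apply: flat_algebraB; [exact: flat_algebra_coord|exact: flat_algebra_cst].
  by apply/seteqP; split=> y /=; rewrite in_itv /= andbT subr_gt0.
by move=> /(_ measurableT B mB).
Qed.

(** The cutoffs give equality on the sets of the pi-system, by dominated
    convergence. The pi-lambda theorem is about measures, so equality of the
    charges is written with their Jordan parts as
    mu+ + nu- = nu+ + mu-. *)
Lemma eq_charge_test_fun (a b : 'I_n -> R) (mu nu : {charge set 'rV[R]_n -> \bar R}) :
  concentrated mu (box a b)° -> concentrated nu (box a b)° ->
  (forall zeta, test_fun a b zeta -> charge_integral mu zeta = charge_integral nu zeta) ->
  forall A, measurable A -> mu A = nu A.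
Proof.
move=> cmu cnu munu.
have mbox : measurable (box a b)° by apply: open_rV_measurable; exact: open_interior.
have to_box (m : {charge set 'rV[R]_n -> \bar R}) A : measurable A ->
    concentrated m (box a b)° -> m A = m (A `&` (box a b)°).
  move=> mA cm; rewrite (chargeDI m mA mbox) [X in (X + _)%E]cm ?add0e//.
    exact: measurableD.
  by rewrite setDE -setIA setICl setI0.
have eqG A : positivity_sets A -> mu A = nu A.
  move=> [u Cu ->]; have mU := flat_algebra_measurable Cu.
  rewrite (to_box mu)// (to_box nu)//.
  set B := _ `&` _; have mB : measurable B by exact: measurableI.
  rewrite -[LHS]fineK ?fin_num_measure// -[RHS]fineK ?fin_num_measure//; congr EFin.
  have mz k : measurable_fun setT (cutoff a b u k).
    by have [] := test_fun_bounded_measurable (test_fun_cutoff a b k Cu).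
  have z01 := cutoff_bound a b u.
  have zB x := @cvg_cutoff _ _ a b u x.
  have cvm := @cvg_charge_integral_indic _ _ mu _ _ mB mz z01 zB.
  have cvn := @cvg_charge_integral_indic _ _ nu _ _ mB mz z01 zB.
  have E : (fun k => charge_integral mu (cutoff a b u k)) =
      (fun k => charge_integral nu (cutoff a b u k)).
    by apply/funext => k; apply: munu; exact: test_fun_cutoff.
  rewrite E in cvm.
  exact: (cvg_unique (@norm_hausdorff _ _) cvm cvn).
pose p (m : {charge set 'rV[R]_n -> \bar R}) := jordan_pos (hahn_posneg m).
pose q (m : {charge set 'rV[R]_n -> \bar R}) := jordan_neg (hahn_posneg m).
have pq (m : {charge set 'rV[R]_n -> \bar R}) A : measurable A ->
    m A = (p m A - q m A)%E.
  by move=> mA; rewrite (jordan_decomp (hahn_posneg m) mA) /cadd /= cscaleN1.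
have pfin m A : measurable A -> p m A \is a fin_num by move=> ?; exact: fin_num_measure.
have qfin m A : measurable A -> q m A \is a fin_num by move=> ?; exact: fin_num_measure.
have cross A : measurable A ->
    (mu A = nu A <-> measure_add (p mu) (q nu) A = measure_add (p nu) (q mu) A).
  have addE m m' : measure_add (p m) (q m') A = (p m A + q m' A)%E.
    by rewrite measure_addE.
  move=> mA; rewrite !addE (pq mu)// (pq nu)//.
  rewrite -(fineK (pfin mu A mA)) -(fineK (qfin mu A mA)).
  rewrite -(fineK (pfin nu A mA)) -(fineK (qfin nu A mA)).
  by split=> /= -[e]; congr EFin; lra.
move=> A mA; apply/(cross A mA).
apply: (measure_unique positivity_sets (fun=> setT)) => //.
- exact: measurable_positivity_sets.
- exact: setI_positivity_sets.
- move=> _; exists (fun=> 1); first exact: flat_algebra_cst.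
  by apply/seteqP; split=> // x _ /=; rewrite ltr01.
- by rewrite bigcup_const.
- move=> B GB; apply/cross; last exact: eqG.
  by case: GB => u Cu ->; exact: flat_algebra_measurable.
- move=> _; rewrite [ltLHS](_ : _ = (p mu setT + q nu setT)%E).
    by rewrite lte_add_pinfty// ltey_eq ?pfin ?qfin.
  exact: measure_addE.
Qed.

End uniqueness.

(** * The one-dimensional factors *)

Section one_factor.
Context {R : realType} (a b : R).
Local Notation sfm := {sigma_finite_measure set (measurableTypeR R) -> \bar R}.
Local Notation leb := (@lebesgue_measure R).
Local Notation J := (`]a, b[%classic : set (measurableTypeR R)).

Lemma test_fun1_bounded_measurable (zeta : R -> R) : test_fun1 a b zeta ->
  bounded_measurable (zeta : measurableTypeR R -> R).
Proof.
move=> [dz _ zab].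
have cz : continuous zeta.
  by move=> x; apply: differentiable_continuous; apply/derivable1_diffP; exact: (dz 0%N).
split; first exact: continuous_measurable_fun.
have : compact (zeta @` `[a, b]).
  apply: continuous_compact; last exact: segment_compact.
  exact: continuous_subspaceT.
move=> /compact_bounded/ex_strict_bound_gt0[M M0 zM].
exists M => x; have [->|z0] := eqVneq (zeta x) 0; first by rewrite normr0 ltW.
apply/ltW/(zM (zeta x)); exists x => //.
apply: subset_itv_oo_cc; apply: zab; exact: subset_closure.
Qed.

Lemma Rintegral_restrict_mul d (T : measurableType d) (m : {measure set T -> \bar R})
    (D : set T) (f g : T -> R) :
  \int[m]_(x in D) (f x * g x) = \int[m]_x ((f \_ D) x * g x).
Proof.
rewrite Rintegral_mkcond; apply: eq_Rintegral => x _.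
by rewrite !patchE; case: ifP => //; rewrite mul0r.
Qed.

Lemma BV1_integrable (f : R -> R) : BV1 a b f ->
  leb.-integrable `[a, b] (EFin \o f).
Proof. by case. Qed.

Lemma BV1_integrable_open (f : R -> R) : BV1 a b f ->
  leb.-integrable setT (EFin \o (f \_ J)).
Proof.
move=> /BV1_integrable fi; rewrite -restrict_EFin.
have mJ : measurable J by exact: measurable_itv.
apply: (integrable_mkcond _ mJ).1.
by apply: integrableS fi => //; exact: subset_itv_oo_cc.
Qed.

(** The density comes from the polar decomposition of the derivative measure;
    the last clause is then the definition of that measure, with the integral
    over the open interval written as one over the line. *)
Lemma derivative_density (f : R -> R) : BV1 a b f ->
  exists (la : sfm) (h : R -> R),
    [/\ has_density (Dmeasure1 a b f) la h, forall t, ~ J t -> h t = 0 &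
      forall zeta, test_fun1 a b zeta -> \int[la]_t (zeta t * h t) =
        - \int[leb]_t ((f \_ J) t * derive1 zeta t)].
Proof.
move=> /Dmeasure1P[cD Df].
have mJ : measurable J by exact: measurable_itv.
have [la [h [Dh h0]]] := polar_decomposition mJ cD.
exists la, h; split=> // zeta tz.
rewrite -(charge_integral_density Dh); last exact: test_fun1_bounded_measurable.
by rewrite Df// Rintegral_restrict_mul.
Qed.

Lemma densityE (f : R -> R) (A : set (measurableTypeR R)) :
  density a b f A = (\int[leb]_(t in A) ((f \_ J) t)%:E)%E.
Proof.
rewrite /density integral_mkcondr; apply: eq_integral => t _.
by rewrite !patchE; case: ifP.
Qed.

Lemma probability_density_norm (f : R -> R) :
  BV1 a b f ->
  {ae leb, forall t, t \in `[a, b] -> 0 <= f t} ->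
  (\int[leb]_(t in `[a, b]) (f t)%:E = 1)%E ->
  (\int[leb]_(t in J) `|(f \_ J) t|%:E = 1)%E.
Proof.
move=> /BV1_integrable fi f0 <-.
have mf : measurable_fun `[a, b] (EFin \o f) := measurable_int _ fi.
have mJ : measurable J by exact: measurable_itv.
have mfJ : measurable_fun J (EFin \o f).
  by apply: measurable_funS mf => //; exact: subset_itv_oo_cc.
rewrite [RHS]integral_itv_bndoo//.
transitivity (\int[leb]_(t in J) `|f t|%:E)%E.
  by apply: eq_integral => t tJ; rewrite patchE tJ.
apply: ae_eq_integral => //.
  by apply/measurable_EFinP; apply: measurableT_comp => //; apply/measurable_EFinP.
apply: (@filterS _ _ (ae_filter_ringOfSetsType leb)) f0 => t f0 /= tJ.
rewrite ger0_norm// f0//.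
exact: subset_itv_oo_cc.
Qed.

(** Both kinds of factors of the tensor product in one form: the derivative
    measure for a direction of differentiation, and [f(t) dt] otherwise. *)
Lemma factor_density (c : bool) (f : R -> R) :
  BV1 a b f ->
  {ae leb, forall t, t \in `[a, b] -> 0 <= f t} ->
  (\int[leb]_(t in `[a, b]) (f t)%:E = 1)%E ->
  exists p : sfm * (R -> R), let la := p.1 in let h := p.2 in
    [/\ la.-integrable setT (EFin \o h), forall t, ~ J t -> h t = 0,
      forall A : set (measurableTypeR R), measurable A ->
        (if c then Dmeasure1 a b f : set _ -> \bar R else density a b f) A =
        (\int[la]_(t in A) (h t)%:E)%E,
      forall zeta, test_fun1 a b zeta -> \int[la]_t (zeta t * h t) =
        if c then - \int[leb]_t ((f \_ J) t * derive1 zeta t)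
        else \int[leb]_t ((f \_ J) t * zeta t) &
      (\int[la]_(t in J) `|h t|%:E)%E =
        if c then charge_tv (Dmeasure1 a b f) J else 1%E].
Proof.
move=> fBV f0 f1; case: c.
  have [la [h [Dh h0 hz]]] := derivative_density fBV.
  exists (la, h); split=> //; first exact: Dh.1.
    exact: Dh.2.
  by rewrite (charge_tv_density Dh).
exists (leb : sfm, f \_ J); split.
- exact: BV1_integrable_open.
- by move=> t tJ /=; rewrite patchE memNset.
- by move=> A _; rewrite densityE.
- by move=> zeta _; apply: eq_Rintegral => t _; rewrite mulrC.
- exact: probability_density_norm.
Qed.

End one_factor.

(** * The mixed derivatives of a product of densities *)

Section tensor_products.
Context {R : realType} (n : nat).
Local Notation sfm := {sigma_finite_measure set (measurableTypeR R) -> \bar R}.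
Local Notation leb := (@lebesgue_measure R).

Lemma tensor_fun_restrict (A : 'I_n -> set R) (g : 'I_n -> R -> R) :
  tensor_fun g \_ (rect A) = tensor_fun (fun j => g j \_ (A j)).
Proof.
apply/funext => x; rewrite patchE; have [xA|xA] := pselect (rect A x).
  rewrite mem_set//.
  by apply: eq_bigr => j _; rewrite patchE mem_set//; exact: xA.
rewrite memNset//; have [j xj] : exists j, ~ A j (x ord0 j) by exact/existsNP.
by rewrite /tensor_fun (bigD1 j)//= patchE memNset// mul0r.
Qed.

Lemma tensor_fun_norm (g : 'I_n -> R -> R) x :
  `|tensor_fun g x| = tensor_fun (fun j t => `|g j t|) x.
Proof. exact: normr_prod. Qed.

Lemma integral_tensor_fun_rect (la : 'I_n -> sfm) (g : 'I_n -> R -> R)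
    (A : 'I_n -> set (measurableTypeR R)) :
  (forall j, (la j).-integrable setT (EFin \o g j)) ->
  (forall j, measurable (A j)) ->
  (\int[prod_rV la]_(x in rect A) (tensor_fun g x)%:E =
   \prod_(j < n) \int[la j]_(t in A j) (g j t)%:E)%E.
Proof.
move=> ig mA.
have igA j : (la j).-integrable setT (EFin \o (g j \_ (A j))).
  rewrite -restrict_EFin; apply: (integrable_mkcond _ (mA j)).1.
  by apply: integrableS (ig j).
rewrite integral_mkcond restrict_EFin tensor_fun_restrict.
have ip := integrable_tensor_fun igA.
rewrite -[LHS]fineK ?integrable_fin_num//.
rewrite -[fine _]/(Rintegral _ _ _) Rintegral_tensor_fun// -prodEFin.
apply: eq_bigr => j _; rewrite [RHS]integral_mkcond restrict_EFin.
by rewrite /Rintegral fineK//; apply: integrable_fin_num => //; exact: igA.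
Qed.

Variables (a b : 'I_n -> R) (I : {set 'I_n}) (f : 'I_n -> R -> R).
Hypothesis fBV : forall j, BV1 (a j) (b j) (f j).
Hypothesis f_ge0 : forall j, {ae leb, forall t, t \in `[a j, b j] -> 0 <= f j t}.
Hypothesis f_int1 : forall j, (\int[leb]_(t in `[a j, b j]) (f j t)%:E = 1)%E.

Lemma integrable_tensor_fun_box :
  (lebesgue_rV n).-integrable (box a b) (EFin \o tensor_fun f).
Proof.
have mJ j : measurable (`[a j, b j]%classic : set (measurableTypeR R)).
  exact: measurable_itv.
have mbox : measurable (box a b) by exact: measurable_rect.
rewrite lebesgue_rVE; apply/(integrable_mkcond _ mbox).
rewrite restrict_EFin tensor_fun_restrict; apply: integrable_tensor_fun => j.
rewrite -restrict_EFin; apply: (integrable_mkcond _ (mJ j)).1.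
exact: BV1_integrable.
Qed.

(** With densities [h j] of the factors with respect to [la j], the charge with
    density [tensor_fun h] with respect to the product of the [la j] represents
    the derivative, by integration by parts, hence agrees with [Dmeasure] on
    measurable sets. Tensor structure and total variation are then integrals of
    product functions over rectangles. *)
Lemma mixed_derivative_tensor_fun :
  [/\ has_mixed_derivative a b I (tensor_fun f),
      is_tensor (Dmeasure a b I (tensor_fun f))
        (fun j => if j \in I then Dmeasure1 (a j) (b j) (f j) : set _ -> \bar R
                  else density (a j) (b j) (f j)) &
      (charge_tv (Dmeasure a b I (tensor_fun f)) (box a b)° =
       \prod_(i in I) charge_tv (Dmeasure1 (a i) (b i) (f i)) `]a i, b i[)%E].
Proof.
have [p pP] := choice (fun j => factor_density (j \in I) (fBV j) (f_ge0 j) (f_int1 j)).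
pose la j := (p j).1; pose h j := (p j).2.
have ih j : (la j).-integrable setT (EFin \o h j) by have [] := pP j.
have h0 j t : ~ `]a j, b j[%classic t -> h j t = 0.
  by have [_ + _ _ _] := pP j; exact.
have hA j (A : set (measurableTypeR R)) : measurable A ->
    (if j \in I then Dmeasure1 (a j) (b j) (f j) : set _ -> \bar R
     else density (a j) (b j) (f j)) A = (\int[la j]_(t in A) (h j t)%:E)%E.
  by have [_ _ + _ _] := pP j; exact.
have hz j zeta : test_fun1 (a j) (b j) zeta -> \int[la j]_t (zeta t * h j t) =
    if j \in I then - \int[leb]_t ((f j \_ `]a j, b j[) t * derive1 zeta t)
    else \int[leb]_t ((f j \_ `]a j, b j[) t * zeta t).
  by have [_ _ _ + _] := pP j; exact.
have htv j : (\int[la j]_(t in `]a j, b j[) `|h j t|%:E)%E =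
    if j \in I then charge_tv (Dmeasure1 (a j) (b j) (f j)) `]a j, b j[ else 1%E.
  by have [] := pP j.
have iH : (sprod_rV la).-integrable setT (EFin \o tensor_fun h).
  exact: integrable_tensor_fun.
pose mu : {charge set 'rV[R]_n -> \bar R} := induced_charge iH.
have muH : has_density mu (sprod_rV la) (tensor_fun h) by split.
have mJ j : measurable (`]a j, b j[%classic : set (measurableTypeR R)).
  exact: measurable_itv.
have mbox : measurable (box a b)°.
  by rewrite interior_box; exact: measurable_rect.
have cmu : concentrated mu (box a b)°.
  move=> A mA AS; rewrite muH.2//; apply: integral0_eq => x Ax.
  have xS : ~ (box a b)° x by move=> Sx; have : set0 x by rewrite -AS.
  move: xS; rewrite interior_box => /existsNP[j xj].
  by rewrite /tensor_fun (bigD1 j)//= h0// mul0r.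
have muD : is_mixed_derivative a b I (tensor_fun f) mu.
  split=> // zeta tz.
  rewrite (charge_integral_density muH); last exact: test_fun_bounded_measurable tz.
  have ig j : leb.-integrable setT (EFin \o (f j \_ `]a j, b j[)).
    exact: BV1_integrable_open.
  rewrite [LHS](tensor_fun_integration_by_parts ih ig hz tz).
  rewrite lebesgue_rVE [in RHS]Rintegral_restrict_mul interior_box tensor_fun_restrict.
  have enumI : [seq j <- enum 'I_n | j \in I] = enum I by rewrite enumT.
  by rewrite enumI cardE -enumI size_filter.
have ID : has_mixed_derivative a b I (tensor_fun f) by exists mu.
set D := Dmeasure a b I (tensor_fun f).
have [cD Dz] : is_mixed_derivative a b I (tensor_fun f) D := DmeasureP ID.
have Dmu A : measurable A -> D A = mu A.
  move=> mA; apply: (eq_charge_test_fun cD cmu) => // zeta tz.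
  by rewrite Dz// muD.2.
have DH : has_density D (sprod_rV la) (tensor_fun h).
  by split=> // A mA; rewrite Dmu.
split=> //.
- move=> A mA; rewrite DH.2; last exact: measurable_rect.
  rewrite [LHS](integral_tensor_fun_rect ih mA); apply: eq_bigr => j _.
  exact/esym/hA.
- rewrite (charge_tv_density DH mbox) interior_box.
  under eq_integral do rewrite tensor_fun_norm.
  rewrite [LHS](integral_tensor_fun_rect (g := fun j t => `|h j t|)) //; last first.
    by move=> j; exact: integrable_norm (ih j).
  rewrite [RHS]big_mkcond; apply: eq_bigr => j _.
  by rewrite htv.
Qed.

End tensor_products.

Theorem propositionA3 (R : realType) (d : nat) (d_ge1 : (1 <= d)%N)
    (a b : 'I_d -> R) (ab : forall j, a j < b j)
    (I : {set 'I_d}) (I_neq0 : I != finset.set0)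
    (f : 'I_d -> R -> R)
    (fBV : forall j, BV1 (a j) (b j) (f j))
    (f_ge0 : forall j, {ae lebesgue_measure,
       forall t, t \in `[a j, b j] -> 0 <= f j t})
    (f_int1 : forall j,
       (\int[lebesgue_measure]_(t in `[a j, b j]) (f j t)%:E = 1)%E) :
  let F : 'rV[R]_d -> R := fun w => \prod_(j < d) f j (w ord0 j) in
  let Df j := Dmeasure1 (a j) (b j) (f j) in
  let fdt j := density (a j) (b j) (f j) in
  [/\ BV a b F,
      (forall i, is_tensor (Dmeasure a b [set i]%SET F)
                   (fun j => if j == i then Df j : set _ -> \bar R else fdt j)),
      (forall i, charge_tv (Dmeasure a b [set i]%SET F) (box a b)°
                 = charge_tv (Df i) `]a i, b i[)
      /\ (TV a b I F = \sum_(i in I) charge_tv (Df i) `]a i, b i[)%E &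
      [/\ has_mixed_derivative a b I F,
          is_tensor (Dmeasure a b I F)
            (fun j => if j \in I then Df j : set _ -> \bar R else fdt j) &
          (charge_tv (Dmeasure a b I F) (box a b)°
           = \prod_(i in I) charge_tv (Df i) `]a i, b i[)%E]].
Proof.
have mixed J := mixed_derivative_tensor_fun J fBV f_ge0 f_int1.
have partial_tv i : charge_tv (Dmeasure a b [set i]%SET (tensor_fun f)) (box a b)°
    = charge_tv (Dmeasure1 (a i) (b i) (f i)) `]a i, b i[.
  by have [_ _ ->] := mixed [set i]%SET; rewrite big_set1.
move=> F Df fdt; split; last exact: mixed.
- split; first exact: integrable_tensor_fun_box.
  by move=> i; have [] := mixed [set i]%SET.
- move=> i A mA; have [_ -> // _] := mixed [set i]%SET.
  by apply: eq_bigr => j _; rewrite finset.in_set1.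
- split=> //; apply: eq_bigr => i _; exact: partial_tv.
Qed.
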